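(* Let $f\colon X\to[-\infty,+\infty]$ be a densely defined lower semicontinuous functional which is bounded above by $M$ and $(K,N)$-convex for some $K<0$ and $N<0$, and set $\tilde M:=-\frac KN e^{-M/N}$. Then $$\mathcal R_1\big(\mathbb{EVI}_{K,N}(f)\big)\subset\mathbb{EVI}_{\tilde M}(f_N)\cap\mathcal C''_N\qquad\text{and}\qquad\mathcal R_2\big(\mathbb{EVI}_{\tilde M}(f_N)\cap\mathcal C''_N\big)\subset\mathbb{EVI}_{K,N}(f).$$ In particular, $\mathcal R_1$ restricted to $\mathbb{EVI}_{K,N}(f)$ is a bijection onto $\mathbb{EVI}_{\tilde M}(f_N)\cap\mathcal C''_N$, and $\mathcal R_2$ restricted to $\mathbb{EVI}_{\tilde M}(f_N)\cap\mathcal C''_N$ is a bijection onto $\mathbb{EVI}_{K,N}(f)$.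
   Context: Setting. $(X,d)$ is a metric space, not necessarily complete, which is strictly intrinsic (any two points are joined by a geodesic in $X$) and whose metric completion is geodesic (complete and strictly intrinsic). A geodesic is a continuous curve $\gamma\colon[0,1]\to X$ with $d(\gamma_s,\gamma_t)=|t-s|\,d(\gamma_0,\gamma_1)$. For $g\colon X\to[-\infty,+\infty]$: $\mathcal D[g]=\{g\ne\pm\infty\}$ and $\mathcal D^\star[g]=\{g<+\infty\}$; ''densely defined'' means that $\mathcal D[f]$ is dense in $X$; $\mathcal D[f]\ne\emptyset$. $f_N:=e^{-f/N}$, with $f_N=0$ where $f=-\infty$ and $f_N=+\infty$ where $f=+\infty$. $\frac{\mathrm d^+}{\mathrm dt}h(t):=\limsup_{\epsilon\downarrow0}\frac{h(t+\epsilon)-h(t)}{\epsilon}$. Functions (for $K<0$, $N<0$, $\theta\ge0$, $t\in[0,1]$): $\mathfrak s_{K,N}(\theta)=\frac{\sin(\theta\sqrt{K/N})}{\sqrt{K/N}}$; $\sigma^{(t)}_{K,N}(\theta)=\frac{\mathfrak s_{K,N}(t\theta)}{\mathfrak s_{K,N}(\theta)}$ if $0<\theta<\pi\sqrt{N/K}$, $=t$ if $\theta=0$, $=+\infty$ if $\theta\ge\pi\sqrt{N/K}$. $(K,N)$-convexity. $f$ is $(K,N)$-convex (with $K<0$, $N<0$) if for all $x_0,x_1\in\mathcal D^\star[f]$ with $\delta:=d(x_0,x_1)<\pi\sqrt{N/K}$ there is a geodesic $\gamma\colon[0,1]\to X$ from $x_0$ to $x_1$ such that $f_N(\gamma_t)\le\sigma^{(1-t)}_{K,N}(\delta)f_N(x_0)+\sigma^{(t)}_{K,N}(\delta)f_N(x_1)$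 for all $t\in[0,1]$ (convention $0\cdot\infty=0$). $\mathbb{EVI}_{K,N}(f)$ is the set of all $\mathrm{EVI}_{K,N}$ gradient curves for $f$, i.e. continuous curves $(y_t)_{t\in(0,T)}\subset\mathcal D[f]$, $T\in(0,+\infty]$, with $$\frac{\mathrm d^+}{\mathrm dt}\Big[\mathfrak s_{K,N}\big(\tfrac{d(y_t,z)}2\big)^2\Big]+K\,\mathfrak s_{K,N}\big(\tfrac{d(y_t,z)}2\big)^2\le\frac N2\Big(1-\frac{f_N(z)}{f_N(y_t)}\Big)$$ for every $t\in(0,T)$ and every $z\in\mathcal D^\star[f]$ with $d(y_t,z)<\pi\sqrt{N/K}$. For $\lambda\in\mathbb R$, $\mathbb{EVI}_\lambda(f_N)$ is the set of all $\mathrm{EVI}_\lambda$ gradient curves for $f_N$ contained in $\mathcal D[f]$, i.e. continuous curves $(z_s)_{s\in(0,T')}\subset\mathcal D[f]$, $T'\in(0,+\infty]$, with $\frac{\mathrm d^+}{\mathrm ds}\frac{d(z_s,z)^2}2+\frac\lambda2d(z_s,z)^2\le f_N(z)-f_N(z_s)$ for every $z\in\mathcal D[f_N]$, $s\in(0,T')$. Reparametrization maps. $\mathcal C'$ is the set of continuous curves $(y_t)_{t\in(0,T)}$ with values in $\mathcal D[f]$, $T\in(0,+\infty]$, such that $t\mapsto f(y_t)$ is non-increasing on $(0,T)$; $\mathcal C''_N$ is the set of $(y_t)_{t\in(0,T)}\in\mathcal C'$ with $\int_0^{T\wedge1}f_N(y_t)\,\mathrm dt<\infty$. Both $\mathbb{EVI}_{K,N}(f)$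 and $\mathbb{EVI}_\lambda(f_N)$ are contained in $\mathcal C'$. $\mathcal R_1\colon\mathcal C'\to\mathcal C''_N$: given $(y_t)_{t\in(0,T)}$, let $\alpha(t)=-N\int_0^t\frac1{f_N(y_r)}\,\mathrm dr$, $T'=\lim_{t\to T^-}\alpha(t)$, $\varphi=\alpha^{-1}\colon(0,T')\to(0,T)$, and $\mathcal R_1((y_t)_{t\in(0,T)})=(y_{\varphi(s)})_{s\in(0,T')}$. $\mathcal R_2\colon\mathcal C''_N\to\mathcal C'$: given $(z_s)_{s\in(0,T')}$, let $\beta(s)=-\frac1N\int_0^sf_N(z_r)\,\mathrm dr$, $T=\lim_{s\to T'^-}\beta(s)$, $\psi=\beta^{-1}\colon(0,T)\to(0,T')$, and $\mathcal R_2((z_s)_{s\in(0,T')})=(z_{\psi(t)})_{t\in(0,T)}$. *)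

(* Defs.v *)
From HB Require Import structures.
From mathcomp Require Import all_boot all_order all_algebra.
From mathcomp Require Import all_classical all_reals all_analysis.

Set Implicit Arguments.
Unset Strict Implicit.
Unset Printing Implicit Defensive.

Import Order.TTheory GRing.Theory Num.Theory.
Import numFieldNormedType.Exports.

Local Open Scope classical_set_scope.
Local Open Scope ring_scope.

(* The distinguished point is only used as a filler value for curves outside
   of their interval of definition, see [curve] below. *)
#[short(type="pmetricType")]
HB.structure Definition PMetric (R : numDomainType) :=
  {T of Pointed T & Metric R T}.

Section intrinsic.
Context {R : realType}.

(* Only the restriction of [g] to [0, 1] matters. *)
Definition geodesic (Y : metricType R) (x y : Y) (g : R -> Y) : Prop :=
  [/\ g 0 = x, g 1 = y, {within `[0, 1], continuous g} &
      forall s t : R, 0 <= s <= 1 -> 0 <= t <= 1 ->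
        mdist (g s) (g t) = `|t - s| * mdist (g 0) (g 1)].

Definition strictly_intrinsic (Y : metricType R) : Prop :=
  forall x y : Y, exists g : R -> Y, geodesic x y g.

Definition metric_complete (Y : metricType R) : Prop :=
  forall F : set_system Y, ProperFilter F -> cauchy F -> exists y : Y, F --> y.

Definition is_completion (X Y : metricType R) (i : X -> Y) : Prop :=
  [/\ forall x x', mdist (i x) (i x') = mdist x x',
      dense (range i) & metric_complete Y].

End intrinsic.

Section functionals.
Context {R : realType} {X : metricType R}.

Definition domain (g : X -> \bar R) : set X := [set x | g x \is a fin_num].

Definition domain_star (g : X -> \bar R) : set X := [set x | (g x < +oo)%E].

(* For [N < 0], [expeR] gives the values [0] where [f = -oo] and [+oo] where
   [f = +oo]. *)
Definition exp_functional (N : R) (f : X -> \bar R) (x : X) : \bar R :=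
  expeR ((- N^-1)%:E * f x)%E.

Definition s_ (K N th : R) : R :=
  sin (th * Num.sqrt (K / N)) / Num.sqrt (K / N).

Definition threshold (K N : R) : R := pi * Num.sqrt (N / K).

(* Meant for [0 <= th]. *)
Definition sigma_ (K N t th : R) : \bar R :=
  if th == 0 then t%:E
  else if th < threshold K N then (s_ K N (t * th) / s_ K N th)%:E
  else +oo%E.

Definition KN_convex (K N : R) (f : X -> \bar R) : Prop :=
  forall x0 x1 : X, domain_star f x0 -> domain_star f x1 ->
    mdist x0 x1 < threshold K N ->
    exists2 g : R -> X, geodesic x0 x1 g &
      forall t : R, 0 <= t <= 1 ->
        (exp_functional N f (g t) <=
           sigma_ K N (1 - t)%R (mdist x0 x1) * exp_functional N f x0 +
           sigma_ K N t (mdist x0 x1) * exp_functional N f x1)%E.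

End functionals.

Section dini.
Context {R : realType}.

Definition upper_right_derivative (h : R -> R) (t : R) : \bar R :=
  limf_esup (fun e => ((h (t + e) - h t) / e)%:E) (0 : R)^'+.

End dini.

Section curves.
Context {R : realType} {X : pmetricType R}.

Definition lifespan (T : \bar R) : set R := [set t | 0 < t /\ (t%:E < T)%E].

(* A curve [(y_t)], [t] in [(0, T)], is encoded as the pair [(T, y)] in which
   [y] is extended by [point] outside of [(0, T)], so that two curves coincide
   exactly when the pairs are equal; [curves_in] requires this normal form. *)
Definition curve : Type := (\bar R * (R -> X))%type.

Definition curves_in (D : set X) : set curve :=
  [set c | [/\ (0 < c.1)%E,
               {within lifespan c.1, continuous c.2},
               forall t, lifespan c.1 t -> D (c.2 t) &
               forall t, ~ lifespan c.1 t -> c.2 t = point]].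

(* The quotient is taken in [R]: both values of [exp_functional] are finite,
   and the one at [c.2 t] is positive. *)
Definition EVI_KN (K N : R) (f : X -> \bar R) : set curve :=
  [set c | curves_in (domain f) c /\
    forall (t : R) (z : X), lifespan c.1 t -> domain_star f z ->
      mdist (c.2 t) z < threshold K N ->
      (upper_right_derivative (fun r => s_ K N (mdist (c.2 r) z / 2) ^+ 2)%R t
         + (K * s_ K N (mdist (c.2 t) z / 2) ^+ 2)%:E <=
       (N / 2 * (1 - fine (exp_functional N f z) /
                     fine (exp_functional N f (c.2 t))))%:E)%E].

(* EVI_lambda gradient curves for [g] contained in [D]. *)
Definition EVI (lambda : R) (g : X -> \bar R) (D : set X) : set curve :=
  [set c | curves_in D c /\
    forall (s : R) (z : X), lifespan c.1 s -> domain g z ->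
      (upper_right_derivative (fun r => mdist (c.2 r) z ^+ 2 / 2)%R s
         + (lambda / 2 * mdist (c.2 s) z ^+ 2)%:E <= g z - g (c.2 s))%E].

Definition Cprime (f : X -> \bar R) : set curve :=
  [set c | curves_in (domain f) c /\
    forall s t, lifespan c.1 s -> lifespan c.1 t -> s <= t ->
      (f (c.2 t) <= f (c.2 s))%E].

Definition Csecond (N : R) (f : X -> \bar R) : set curve :=
  [set c | Cprime f c /\
    (\int[lebesgue_measure]_(t in lifespan (Order.min c.1 1%E))
       exp_functional N f (c.2 t) < +oo)%E].

(* [lim_{t -> T^-} h t] for [T > 0]. *)
Definition lim_at_end (h : R -> R) (T : \bar R) : \bar R :=
  match T with
  | r%:E => lim ((h t)%:E @[t --> r^'-])
  | +oo%E => lim ((h t)%:E @[t --> +oo%R])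
  | -oo%E => 0%E
  end.

(* [clock] is the time change [alpha], increasing on the lifespan of [c]; its
   inverse there is given by [pinv]. *)
Definition reparametrize (clock : R -> R) (c : curve) : curve :=
  let T' := lim_at_end clock c.1 in
  (T', (c.2 \o pinv (lifespan c.1) clock) \_ (lifespan T')).

(* [R1] is only meaningful on [Cprime f], and [R2] on [Csecond N f]. *)
Definition R1 (N : R) (f : X -> \bar R) (c : curve) : curve :=
  reparametrize (fun t => - N * \int[lebesgue_measure]_(r in `]0, t[)
                   (fine (exp_functional N f (c.2 r)))^-1) c.

Definition R2 (N : R) (f : X -> \bar R) (c : curve) : curve :=
  reparametrize (fun s => - N^-1 * \int[lebesgue_measure]_(r in `]0, s[)
                   fine (exp_functional N f (c.2 r))) c.

End curves.

(* Main.v *)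
Require Import Defs.
From mathcomp Require Import all_boot all_order all_algebra.
From mathcomp Require Import all_classical all_reals all_analysis.
From mathcomp Require Import measurable_realfun ring lra.

Set Implicit Arguments.
Unset Strict Implicit.
Unset Printing Implicit Defensive.

Import Order.TTheory GRing.Theory Num.Theory.
Import numFieldNormedType.Exports.

Local Open Scope classical_set_scope.
Local Open Scope ring_scope.

(* Write F = f_N, C = e^(-M/N) >= F and om = sqrt(K/N). Changing the time by
   the clock of R1 or R2 multiplies right derivatives by F(y)/(-N) or its
   inverse, so that both EVIs become conditions at a single point y of the
   curve:
     (KN)      D+ s(d/2)^2 <= (F z - F y)/2 + om^2 F(y) s(d/2)^2   if d < pi/om,
     (lambda)  D+ d^2/2    <= F z - F y + C om^2 d^2/2             for all z,
   where d = d(y, z). To pass from one to the other, replace z with a point x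
   close to y between y and z: by the triangle inequality, D+ d(., z) <=
   D+ d(., x). For (lambda) => (KN), x moves to y along a geodesic provided by
   the (K,N)-convexity. For (KN) => (lambda), z may be too far away for the
   convexity to apply, and x is the first point of a chain from y to z that
   nearly minimizes the sum of the values of F. The two time changes are inverse
   to each other because a continuous function is determined by its right
   derivative and its limit at 0. *)

(** * Upper bounds on right Dini derivatives *)

Section dini.
Context {R : realType}.
Implicit Types (h u : R -> R) (t a : R).

(** The bound on the upper right derivative is written with real increments, so that comparison and
    chain rules need no extended-real limsup. *)
Definition dini_le h t a := forall eps, 0 < eps ->
  \forall e \near (0 : R)^'+, h (t + e) - h t <= (a + eps) * e.

Lemma dini_leP h t a :
  (upper_right_derivative h t <= a%:E)%E <-> dini_le h t a.
Proof.
rewrite /upper_right_derivative limf_esupE; split=> [le_a eps eps0|le_a].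
- have /ereal_inf_lt[_ [V V0 <-] supV] :
      (ereal_inf [set ereal_sup ((fun e => ((h (t + e) - h t) / e)%:E) @` V) |
         V in (0 : R)^'+] < (a + eps)%:E)%E.
    by rewrite (le_lt_trans le_a)// lte_fin ltrDl.
  near=> e; have e0 : 0 < e by near: e; exact: nbhs_right_gt.
  rewrite -ler_pdivrMr// -lee_fin (le_trans _ (ltW supV))//.
  apply: ereal_sup_ubound => /=; exists e => //.
  by near: e.
- apply/lee_addgt0Pr => eps eps0; apply: ge_ereal_inf.
  exists (ereal_sup ((fun e => ((h (t + e) - h t) / e)%:E) @`
      [set e | 0 < e /\ h (t + e) - h t <= (a + eps) * e])).
    exists [set e | 0 < e /\ h (t + e) - h t <= (a + eps) * e] => //.
    near=> e; split; first by near: e; exact: nbhs_right_gt.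
    by near: e; exact: le_a.
  apply: ge_ereal_sup => _ [e [e0 he] <-].
  by rewrite -EFinD lee_fin ler_pdivrMr.
Unshelve. all: by end_near. Qed.

Lemma near_dini_le h u t a : u t = h t ->
  (\forall e \near (0 : R)^'+, u (t + e) = h (t + e)) ->
  dini_le h t a -> dini_le u t a.
Proof.
move=> ut eq_uh dh eps eps0; near=> e; rewrite ut.
rewrite (_ : u (t + e) = h (t + e)); last by near: e.
by near: e; exact: dh.
Unshelve. all: by end_near. Qed.

Lemma le_dini_le h u t a : (\forall e \near (0 : R)^'+, u (t + e) - u t <= h (t + e) - h t) ->
  dini_le h t a -> dini_le u t a.
Proof.
move=> le_uh dh eps eps0; near=> e; apply: (@le_trans _ _ (h (t + e) - h t)).
  by near: e.
by near: e; exact: dh.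
Unshelve. all: by end_near. Qed.

Lemma dini_le_weaken h t a b : a <= b -> dini_le h t a -> dini_le h t b.
Proof.
move=> ab dh eps eps0; near=> e.
apply: (@le_trans _ _ ((a + eps) * e)); first by near: e; exact: dh.
by rewrite ler_wpM2r ?lerD2r//; apply/ltW; near: e; exact: nbhs_right_gt.
Unshelve. all: by end_near. Qed.

Lemma dini_le_lim h t a : (forall eps, 0 < eps -> dini_le h t (a + eps)) -> dini_le h t a.
Proof.
move=> dh eps eps0; have e20 : 0 < eps / 2 by rewrite divr_gt0.
by have := dh _ e20 _ e20; rewrite -addrA -splitr.
Qed.

(** Lets an auxiliary point tend to the curve: a Dini bound is closed in the slope, so bounds [b x]
    that hold along [F] pass to their limit. *)
Lemma dini_le_cvg h t {I : Type} (F : set_system I) {FF : ProperFilter F} (b : I -> R) a :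
  (b x @[x --> F] --> a) -> (\forall x \near F, dini_le h t (b x)) -> dini_le h t a.
Proof.
move=> ba db; apply: dini_le_lim => eps eps0.
have : \forall x \near F, b x <= a + eps.
  by apply: cvgr_le ba _ _; rewrite ltrDl.
move=> lb; have [x [bx dx]] := filter_ex (filterI lb db).
exact: dini_le_weaken bx dx.
Qed.

(** Common core of the chain rule and of the change of time: [k e] is a ratio of increments that
    tends to [p]. *)
Lemma dini_le_comp_ratio u (s : R) (k : R -> R) (p a : R) : 0 < p ->
  k e @[e --> (0 : R)^'+] --> p ->
  (forall eps, 0 < eps -> \forall e \near (0 : R)^'+, u (s + e) - u s <= k e * (a + eps) * e) ->
  dini_le u s (p * a).
Proof.
move=> p0 kp ule eps eps0.
(* With this slack, multiplication by [p] costs [eps / 2]; the other half absorbs the convergence of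
   [k]. *)
have d0 : 0 < eps / (2 * p) by rewrite divr_gt0// mulr_gt0.
near=> e.
have e0 : 0 < e by near: e; exact: nbhs_right_gt.
apply: (@le_trans _ _ (k e * (a + eps / (2 * p)) * e)); first by near: e; exact: ule.
rewrite ler_pM2r//; near: e.
apply: (@cvgr_le _ _ _ _ (fun e => k e * (a + eps / (2 * p))) (p * (a + eps / (2 * p)))).
  exact: cvgMl.
rewrite mulrDr ltrD2l (_ : p * (eps / (2 * p)) = eps / 2); last first.
  by field; rewrite gt_eqF.
by rewrite ltr_pdivrMr// ltr_pMr// ltr1n.
Unshelve. all: by end_near. Qed.

Lemma cvg_dini_le h t a :
  (h (t + e) - h t) / e @[e --> (0 : R)^'+] --> a -> dini_le h t a.
Proof.
move=> ha eps eps0; near=> e.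
have e0 : 0 < e by near: e; exact: nbhs_right_gt.
rewrite -ler_pdivrMr//; near: e.
by apply: cvgr_le ha _ _; rewrite ltrDl.
Unshelve. all: by end_near. Qed.

(** The point is the supremum of [S]: if it were outside [P], so would be a whole neighbourhood, and
    [S] could not accumulate there. This continuity induction underlies the mean value inequality
    and the monotonicity of [f_N] along EVI curves. *)
Lemma last_point (P : set R) a b : a <= b -> P a ->
  (forall t, a < t <= b -> ~ P t -> \forall r \near t, ~ P r) ->
  exists r, [/\ a <= r <= b, P r & forall t, r < t <= b -> ~ P t].
Proof.
move=> ab Pa Pop; pose S := [set t | a <= t <= b /\ P t].
have Sa : S a by split => //; rewrite lexx ab.
have supS : has_sup S by split; [exists a|exists b => t [/andP[]]].
have aS : a <= sup S by apply: ub_le_sup => //; case: supS.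
have Sb : sup S <= b by apply: ge_sup => [|t [/andP[]]//]; exists a.
have nP t : sup S < t <= b -> ~ P t.
  move=> /andP[St tb] Pt.
  have : t <= sup S; last by rewrite leNgt St.
  apply: ub_le_sup; first by case: supS.
  by split => //; rewrite tb andbT (le_trans aS)// ltW.
exists (sup S); split => //; first by rewrite aS Sb.
apply: contrapT => nPS.
have aS' : a < sup S <= b.
  by rewrite Sb andbT lt_neqAle aS andbT; apply: contra_not_neq nPS => <-.
have /nbhs_ballP[d /= d0 dP] := Pop _ aS' nPS.
have [t [tab Pt] dt] := sup_adherent d0 supS.
apply: (dP t) => //; rewrite /ball/= ger0_norm ?subr_ge0; first lra.
by apply: ub_le_sup => //; case: supS.
Qed.

(** Mean value inequality. For [B > A], at the last [r] where [h r - B * r <= h a - B * a] the Dini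
    bound extends the inequality to the right of [r], so [r = b]; then [B] tends to [A]. *)
Lemma dini_le_increment h a b A : a <= b ->
  (forall t, a <= t <= b -> {for t, continuous h}) ->
  (forall t, a <= t < b -> dini_le h t A) -> h b - h a <= A * (b - a).
Proof.
move=> ab ch dh.
have slope B : A < B -> h b - B * b <= h a - B * a.
  move=> AB; have [||r [/andP[ar rb] /= hr nr]] :=
      @last_point [set t | h t - B * t <= h a - B * a] a b ab.
  - exact: lexx.
  - move=> t /andP[/ltW a_t tb] /=/negP; rewrite -ltNge => lt_t.
    have cht : (fun x => h x - B * x) x @[x --> t] --> h t - B * t.
      apply: cvgB; last by apply: cvgMr; exact: cvg_id.
      by apply: ch; rewrite a_t.
    apply: filterS (cvgr_gt _ cht _ lt_t) => x /=.
    by rewrite ltNge => /negP.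
  - move: rb; rewrite le_eqVlt => /predU1P[<- //|rb].
    have BA : 0 < B - A by rewrite subr_gt0.
    have : \forall e \near (0 : R)^'+, False; last by case/filter_ex.
    have dr := dh r _ _ BA; near=> e.
    have e0 : 0 < e by near: e; exact: nbhs_right_gt.
    apply: (nr (r + e)).
      rewrite ltrDl e0/= -lerBrDl; near: e; apply: nbhs_right_le.
      by rewrite subr_gt0.
    apply: le_trans hr; rewrite /= -subr_le0.
    have : h (r + e) - h r <= (A + (B - A)) * e.
      by near: e; apply: dr; rewrite ar rb.
    by lra.
apply/ler_addgt0Pr => _/posnumP[eps].
(* The [+ 1] keeps the denominator positive when [a = b]. *)
have ba : 0 < b - a + 1 by rewrite ltr_wpDl// subr_ge0.
have := slope (A + eps%:num / (b - a + 1)); rewrite ltrDl divr_gt0// => /(_ isT).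
have : eps%:num / (b - a + 1) * (b - a) <= eps%:num.
  by rewrite mulrAC ler_pdivrMr// ler_pM2l// lerDl.
set x := _ / _; nra.
Unshelve. all: by end_near. Qed.
End dini.

(** * Clocks and their inverses *)

Section clock.
Context {R : realType}.
Implicit Types (T : \bar R) (al : R -> R).

(** Allows the increment of [f] to replace [e] in a right limit at 0, as needed for inverse
    functions and changes of time. *)
Lemma cvg_at_right_increment (f : R -> R) s : {for s, continuous f} ->
  (\forall e \near (0 : R)^'+, f s < f (s + e)) ->
  (f (s + e) - f s) @[e --> (0 : R)^'+] --> (0 : R)^'+.
Proof.
move=> cf incr A /= /nbhs_ballP[d /= d0 dA].
have cfs : f (s + e) @[e --> (0 : R)^'+] --> f s.
  apply: cvg_at_right_filter.
  have : s + e @[e --> 0] --> s + 0 by apply: cvgD; [exact: cvg_cst|exact: cvg_id].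
  by rewrite addr0 => /cvg_comp; exact.
suff : \forall e \near (0 : R)^'+, A (f (s + e) - f s) by [].
near=> e; apply: dA.
  rewrite /ball/= sub0r normrN distrC; near: e.
  exact: cvgr_dist_lt cfs _ d0.
by rewrite subr_gt0; near: e.
Unshelve. all: by end_near. Qed.

Lemma lifespan_le T r t : lifespan T t -> 0 < r -> r <= t -> lifespan T r.
Proof. by move=> [t0 tT] r0 rt; split => //; rewrite (le_lt_trans _ tT)// lee_fin. Qed.

Lemma lifespan_itv T a b r : lifespan T a -> lifespan T b -> a <= r <= b -> lifespan T r.
Proof. by move=> [a0 _] bT /andP[ar rb]; apply: lifespan_le bT _ rb; exact: lt_le_trans ar. Qed.

Lemma lifespan_extend T b : lifespan T b -> exists2 d, 0 < d & lifespan T (b + d).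
Proof.
move: T => [r||] [b0]; rewrite /= ?lte_fin => bT //.
  exists ((r - b) / 2); first by rewrite divr_gt0// subr_gt0.
  by split; rewrite ?lte_fin; lra.
by exists 1 => //; split; rewrite ?ltry//; lra.
Qed.

Lemma near_lifespan T t : lifespan T t -> \forall r \near t, lifespan T r.
Proof.
move=> tT; have [d d0 dT] := lifespan_extend tT.
have [t0 _] := tT; near=> r; apply: (lifespan_le dT).
  by near: r; exact: lt_nbhsr.
by apply: ltW; near: r; apply: lt_nbhsl; rewrite ltrDl.
Unshelve. all: by end_near. Qed.

Lemma near_right_lifespan T t : lifespan T t -> \forall e \near (0 : R)^'+, lifespan T (t + e).
Proof.
move=> tT; have [d d0 dT] := lifespan_extend tT; near=> e.
have e0 : 0 < e by near: e; exact: nbhs_right_gt.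
apply: (lifespan_le dT); first by rewrite addr_gt0//; case: tT.
by rewrite lerD2l; near: e; exact: nbhs_right_le.
Unshelve. all: by end_near. Qed.

(** What the two time changes have in common and what suffices to invert them. Given monotonicity
    and positivity, [clock_at0] says that [al] tends to 0 at 0. *)
Record clock T al : Prop := Clock {
  clock_mono : forall s t, lifespan T s -> lifespan T t -> s < t -> al s < al t ;
  clock_cont : forall t, lifespan T t -> {for t, continuous al} ;
  clock_gt0 : forall t, lifespan T t -> 0 < al t ;
  clock_at0 : forall eps, 0 < eps -> exists2 t, lifespan T t & al t < eps }.

Lemma clock_le T al s t : clock T al -> lifespan T s -> lifespan T t -> (al s <= al t) = (s <= t).
Proof.
move=> cal sT tT; apply/idP/idP; last first.
  by rewrite le_eqVlt => /predU1P[->//|/(clock_mono cal sT tT)/ltW].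
by apply: contraTT; rewrite -!ltNge; exact: (clock_mono cal).
Qed.

Lemma clock_inj T al s t : clock T al -> lifespan T s -> lifespan T t -> al s = al t -> s = t.
Proof.
move=> cal sT tT e; apply/eqP.
by rewrite eq_le -(clock_le cal sT tT) -(clock_le cal tT sT) e lexx.
Qed.

Let end_sup T al : \bar R := ereal_sup [set (al t)%:E | t in lifespan T].

(** The filter [F] stands for either approach to the end, from the left at a finite [T] or at
    infinity; by monotonicity the limit is the supremum. *)
Lemma cvg_clock T al (F : set_system R) {FF : ProperFilter F} : clock T al ->
  (\forall t \near F, lifespan T t) ->
  (forall s, lifespan T s -> \forall t \near F, s < t) ->
  (al t)%:E @[t --> F] --> end_sup T al.
Proof.
move=> cal FT Fs; have [t0 t0T] := filter_ex FT.
have ub t : lifespan T t -> ((al t)%:E <= end_sup T al)%E.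
  by move=> tT; apply: ereal_sup_ubound => /=; exists t.
have near_gt a : (a%:E < end_sup T al)%E -> \forall t \near F, a < al t.
  move=> /ereal_sup_gt[_ [s sT <-]]; rewrite lte_fin => as_.
  near=> t; apply: (lt_trans as_); apply: (clock_mono cal) => //.
    by near: t.
  by near: t; exact: Fs.
have := ub _ t0T; move: near_gt ub; case: (end_sup T al) => [l||] // near_gt ub _.
  apply: cvg_EFin; first exact: nearW.
  apply/cvgrPdist_le => /= eps eps0; near=> t.
  have tT : lifespan T t by near: t.
  rewrite ger0_norm; last by rewrite subr_ge0 -lee_fin ub.
  rewrite lerBlDl -lerBlDr; apply/ltW; near: t; apply: near_gt.
  by rewrite lte_fin ltrBlDr ltrDl.
apply/cvgeyPge => A; near=> t; rewrite lee_fin; apply/ltW; near: t.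
by apply: near_gt; rewrite ltry.
Unshelve. all: by end_near. Qed.

Lemma lim_at_end_clock T al : (0 < T)%E -> clock T al ->
  lim_at_end al T = ereal_sup [set (al t)%:E | t in lifespan T].
Proof.
move: T => [r||] // T0 cal; apply: cvg_lim => //; apply: (@cvg_clock _ _ _ _ cal).
- near=> t; split; first by near: t; exact: nbhs_left_gt.
  by rewrite lte_fin; near: t; exact: nbhs_left_lt.
- by move=> s [_ sT]; exact: nbhs_left_gt.
- near=> t; split; last by rewrite ltry.
  by near: t; apply: nbhs_pinfty_gt; exact: num_real.
- by move=> s _; apply: nbhs_pinfty_gt; exact: num_real.
Unshelve. all: by end_near. Qed.

Lemma lifespan_gt0 T : (0 < T)%E -> exists t, lifespan T t.
Proof.
move: T => [r||] // T0; last by exists 1; split => //; rewrite ltry.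
by exists (r / 2); rewrite lte_fin in T0; split; rewrite ?lte_fin; lra.
Qed.

Section inverse.
Variables (T : \bar R) (al : R -> R).
Hypotheses (T0 : (0 < T)%E) (cal : clock T al).
Let T' := lim_at_end al T.
Let phi := pinv (lifespan T) al.

Lemma clock_end_gt0 : (0 < T')%E.
Proof.
rewrite /T' lim_at_end_clock//; have [t tT] := lifespan_gt0 T0.
apply: (@lt_le_trans _ _ (al t)%:E); first by rewrite lte_fin (clock_gt0 cal).
by apply: ereal_sup_ubound; exists t.
Qed.

Lemma clock_lifespan t : lifespan T t -> lifespan T' (al t).
Proof.
move=> tT; split; first by have := clock_gt0 cal tT.
have [d d0 dT] := lifespan_extend tT.
apply: (@lt_le_trans _ _ (al (t + d))%:E).
  by rewrite lte_fin; apply: (clock_mono cal) => //; rewrite ltrDl.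
rewrite /T' lim_at_end_clock//; apply: ereal_sup_ubound.
by exists (t + d).
Qed.

(** Intermediate value theorem between a point provided by [clock_at0] and one provided by the
    supremum. *)
Lemma clock_surj s : lifespan T' s -> exists2 t, lifespan T t & al t = s.
Proof.
move=> [s0]; rewrite /T' lim_at_end_clock// => /ereal_sup_gt[_ [b bT <-]].
rewrite lte_fin => sb; have [a aT as_] := clock_at0 cal s0.
have ab : a <= b by rewrite -(clock_le cal aT bT) (ltW (lt_trans as_ sb)).
have cab : {within `[a, b], continuous al}.
  apply: continuous_in_subspaceT => x; rewrite inE/= in_itv/= => xab.
  exact: (clock_cont cal (lifespan_itv aT bT xab)).
have [|c] := @IVT _ al a b s ab cab.
  by rewrite ge_min (ltW as_)/= le_max (ltW sb) orbT.
by rewrite in_itv/= => cab' <-; exists c => //; exact: lifespan_itv aT bT cab'.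
Qed.

Lemma pinv_clockK t : lifespan T t -> phi (al t) = t.
Proof.
move=> tT; apply: pinvKV; last by rewrite inE.
by move=> x y; rewrite !inE => xT yT; exact: clock_inj cal xT yT.
Qed.

Lemma clock_pinvK s : lifespan T' s -> al (phi s) = s.
Proof. by move=> /clock_surj[t tT <-]; rewrite pinv_clockK. Qed.

Lemma pinv_clock_lifespan s : lifespan T' s -> lifespan T (phi s).
Proof. by move=> /clock_surj[t tT <-]; rewrite pinv_clockK. Qed.

Lemma pinv_clock : clock T' phi.
Proof.
have mono s t : lifespan T' s -> lifespan T' t -> s < t -> phi s < phi t.
  move=> sT tT; apply: contraTT; rewrite -!leNgt.
  have := clock_le cal (pinv_clock_lifespan tT) (pinv_clock_lifespan sT).
  by rewrite !clock_pinvK// => ->.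
split => //.
- move=> s sT; apply/cvgrPdist_lt => eps eps0.
  have pT := pinv_clock_lifespan sT; have [p0 _] := pT.
  have [d d0 dT] := lifespan_extend pT.
  (* [a] and [b] lie within [eps / 2] of [phi s], and [phi s / 2] and [phi s + d] keep them in the
     lifespan. Points close to [s] lie between [al a] and [al b], so [phi] sends them between [a]
     and [b]. *)
  pose a := Num.max (phi s / 2) (phi s - eps / 2).
  pose b := Num.min (phi s + d) (phi s + eps / 2).
  have aps : a < phi s by rewrite /a gt_max; apply/andP; split; lra.
  have psb : phi s < b by rewrite /b lt_min; apply/andP; split; lra.
  have aT : lifespan T a.
    by apply: lifespan_le pT _ (ltW aps); rewrite lt_max divr_gt0.
  have bT : lifespan T b.
    by apply: lifespan_le dT (lt_trans p0 psb) _; rewrite ge_min lexx.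
  near=> x; have xT : lifespan T' x by near: x; exact: near_lifespan.
  have xa : a < phi x.
    rewrite -(pinv_clockK aT); apply: mono => //; first exact: clock_lifespan.
    near: x; apply: lt_nbhsr; rewrite -[ltRHS]clock_pinvK//.
    exact: (clock_mono cal).
  have xb : phi x < b.
    rewrite -(pinv_clockK bT); apply: mono => //; first exact: clock_lifespan.
    near: x; apply: lt_nbhsl; rewrite -[ltLHS]clock_pinvK//.
    exact: (clock_mono cal).
  have : phi s - eps / 2 <= a by rewrite /a le_max lexx orbT.
  have : b <= phi s + eps / 2 by rewrite /b ge_min lexx orbT.
  move=> ? ?; rewrite ltr_norml; apply/andP; split; lra.
- by move=> s /pinv_clock_lifespan[].
- move=> eps eps0; have [t tT] := lifespan_gt0 T0.
  have t'T : lifespan T (Num.min t (eps / 2)).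
    apply: (lifespan_le tT); last by rewrite ge_min lexx.
    by rewrite lt_min divr_gt0// andbT; case: tT.
  exists (al (Num.min t (eps / 2))); first exact: clock_lifespan.
  by rewrite pinv_clockK// gt_min; apply/orP; right; lra.
Unshelve. all: by end_near. Qed.

Lemma lim_at_end_pinv : lim_at_end phi T' = T.
Proof.
rewrite lim_at_end_clock; [|exact: clock_end_gt0|exact: pinv_clock].
apply/eqP; rewrite eq_le; apply/andP; split.
  apply: ge_ereal_sup => _ [s /pinv_clock_lifespan[_ /ltW sT] <-]; exact: sT.
have le_sup t : lifespan T t ->
    (t%:E <= ereal_sup [set (phi s)%:E | s in lifespan T'])%E.
  move=> tT; apply: ereal_sup_ubound; exists (al t); first exact: clock_lifespan.
  by rewrite pinv_clockK.
(* A supremum [b] below [T] would lie in the lifespan, which extends beyond [b], against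
   [le_sup]. *)
rewrite leNgt; apply/negP => lt_T.
have [t0 t0T] := lifespan_gt0 T0.
have supfin : ereal_sup [set (phi s)%:E | s in lifespan T'] \is a fin_num.
  rewrite fin_numElt (lt_le_trans (ltNyr t0) (le_sup _ t0T))/=.
  by rewrite (lt_le_trans lt_T) ?leey.
move: lt_T le_sup; rewrite -(fineK supfin); set b := fine _ => bT le_sup.
have b0 : 0 < b by rewrite (lt_le_trans t0T.1)// -lee_fin le_sup.
have [|d d0 dT] := @lifespan_extend T b; first by split.
by have := le_sup _ dT; rewrite lee_fin gerDl leNgt d0.
Qed.

(** Substitute [phi (s + e) - phi s] for the increment in the quotient of [al]: it tends to 0 from
    the right because [phi] increases, so right derivatives suffice. *)
Lemma pinv_clock_rderiv (s p : R) : lifespan T' s -> 0 < p ->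
  (al (phi s + e) - al (phi s)) / e @[e --> (0 : R)^'+] --> p ->
  (phi (s + e) - phi s) / e @[e --> (0 : R)^'+] --> p^-1.
Proof.
move=> sT p0 dal.
have cphi : (phi (s + e) - phi s) @[e --> (0 : R)^'+] --> (0 : R)^'+.
  apply: cvg_at_right_increment; first exact: clock_cont pinv_clock _ sT.
  near=> e; apply: (clock_mono pinv_clock) => //.
    by near: e; exact: near_right_lifespan.
  by rewrite ltrDl; near: e; exact: nbhs_right_gt.
have H : ((al (phi s + (phi (s + e) - phi s)) - al (phi s)) / (phi (s + e) - phi s))^-1
    @[e --> (0 : R)^'+] --> p^-1.
  by apply: cvgV; [exact: lt0r_neq0|exact: cvg_comp _ _ cphi dal].
apply: cvg_trans H; apply: near_eq_cvg; near=> e => /=.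
have sT' : lifespan T' (s + e) by near: e; exact: near_right_lifespan.
rewrite [phi s + _]addrC subrK !clock_pinvK// (addrC s) addrK invf_div//.
Unshelve. all: by end_near. Qed.
End inverse.

End clock.

(** * Clocks given by integrals *)

Section integral_clock.
Context {R : realType}.
Implicit Types (T : \bar R) (al w : R -> R).

(** By monotonicity the sets where [w >= r] are intervals. *)
Lemma nondecreasing_in_measurable (D : set R) w : is_interval D ->
  (forall s t, D s -> D t -> s <= t -> w s <= w t) -> measurable_fun D w.
Proof.
move=> iD w_nd mD; move: mD.
apply: (measurability (@RGenCInfty.G R)) => [|/= _ [_] [r] -> <-].
  exact: RGenCInfty.measurableE.
apply: is_interval_measurable => s t /= [Ds ws] [Dt wt] u sut.
have Du : D u by exact: iD Ds Dt _ sut.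
move: ws; rewrite /= !in_itv/= !andbT => ws; split => //.
by rewrite (le_trans ws)// w_nd//; case/andP: sut.
Qed.

Lemma nonincreasing_in_measurable (D : set R) w : is_interval D ->
  (forall s t, D s -> D t -> s <= t -> w t <= w s) -> measurable_fun D w.
Proof.
move=> iD w_ni; rewrite -(opprK w); apply/measurable_funN.
by apply: nondecreasing_in_measurable => // s t Ds Dt st; rewrite lerN2 w_ni.
Qed.

Section primitive.
Variables (T : \bar R) (w : R -> R) (k : R).
Hypotheses (T0 : (0 < T)%E) (k0 : 0 < k).
Hypothesis mw : forall t, lifespan T t -> measurable_fun `]0, t[ w.
Hypothesis w0 : forall t, lifespan T t -> 0 < w t.
Hypothesis w_ub : forall t, lifespan T t -> exists B, forall r : R, 0 < r < t -> w r <= B.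
Hypothesis w_right : forall t, lifespan T t -> w (t + e) @[e --> (0 : R)^'+] --> w t.

Let al t := k * \int[lebesgue_measure]_(r in `]0, t[) w r.

Let itv_lifespan t r : lifespan T t -> r \in `]0, t[ -> lifespan T r.
Proof.
by move=> tT; rewrite in_itv/= => /andP[r0 rt]; apply: (lifespan_le tT) r0 (ltW rt).
Qed.

Let intw t : lifespan T t -> lebesgue_measure.-integrable `]0, t[ (EFin \o w).
Proof.
move=> tT; have [B wB] := w_ub tT.
apply: measurable_bounded_integrable => //; last 1 first.
- exists (Num.max B 0); split; first exact: num_real.
  move=> x Bx r /=; rewrite in_itv/= => r0t.
  rewrite ger0_norm; last by apply/ltW/w0/(itv_lifespan tT); rewrite in_itv.
  by rewrite (le_trans (wB _ r0t))// (le_trans _ (ltW Bx))// le_max lexx.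
- by rewrite /= lebesgue_measure_itv/=; case: ifP => // _; rewrite -EFinD ltry.
- exact: mw.
Qed.

Let al_incr a b : lifespan T a -> lifespan T b -> a <= b ->
  al b - al a = k * \int[lebesgue_measure]_(r in `]a, b[) w r.
Proof.
move=> aT bT ab; rewrite -mulrBr; congr (_ * _).
have [<-|anb] := eqVneq a b.
  by rewrite subrr set_itv_ge ?Rintegral_set0// bnd_simp ltxx.
have a_lt_b : a < b by rewrite lt_neqAle anb.
rewrite (Rintegral_itv_bndo_bndc (intw aT)) Rintegral_itvB//.
- exact: intw.
- by rewrite bnd_simp; case: aT => /ltW.
Qed.

Let len a b : a <= b -> fine (lebesgue_measure (`]a, b[ : set R)) = b - a.
Proof.
move=> ab; rewrite lebesgue_measure_itv/= lte_fin.
by case: ltP => // ba; apply/eqP; rewrite eq_sym subr_eq0 eq_le ab ba.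
Qed.

Let intw_sub a b : lifespan T a -> lifespan T b ->
  lebesgue_measure.-integrable `]a, b[ (EFin \o w).
Proof.
move=> aT bT; apply: integrableS (intw bT) => //.
by apply: subset_itvr; rewrite bnd_simp; case: aT => /ltW.
Qed.

Let int_cst a b (c : R) : lebesgue_measure.-integrable (`]a, b[ : set R) (EFin \o cst c).
Proof.
apply: measurable_bounded_integrable => //.
  by rewrite /= lebesgue_measure_itv/=; case: ifP => // _; rewrite -EFinD ltry.
exists `|c|; split; first exact: num_real.
by move=> x cx r _ /=; exact: ltW.
Qed.

Let al_ge a b m : lifespan T a -> lifespan T b -> a <= b ->
  (forall r, a < r < b -> m <= w r) -> k * m * (b - a) <= al b - al a.
Proof.
move=> aT bT ab mw'; rewrite al_incr// -mulrA ler_pM2l//.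
rewrite -(len ab) -Rintegral_cst//; apply: le_Rintegral => //.
- exact: int_cst.
- exact: intw_sub.
Qed.

Let al_le a b m : lifespan T a -> lifespan T b -> a <= b ->
  (forall r, a < r < b -> w r <= m) -> al b - al a <= k * m * (b - a).
Proof.
move=> aT bT ab mw'; rewrite al_incr// -mulrA ler_pM2l//.
rewrite -(len ab) -Rintegral_cst//; apply: le_Rintegral => //.
- exact: intw_sub.
- exact: int_cst.
Qed.

Let al_le0 t B : lifespan T t -> (forall r, 0 < r < t -> w r <= B) -> al t <= k * B * t.
Proof.
move=> tT wB; rewrite -mulrA ler_pM2l//.
rewrite -[X in _ <= B * X]subr0 -(len (ltW tT.1)) -Rintegral_cst//; apply: le_Rintegral => //.
- exact: intw.
- exact: int_cst.
Qed.

Let near_w t eps : lifespan T t -> 0 < eps ->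
  exists2 d, 0 < d & lifespan T (t + d) /\
    forall r, t < r < t + d -> w t - eps <= w r <= w t + eps.
Proof.
move=> tT eps0; have [d0 d00 d0T] := lifespan_extend tT.
have /cvgrPdist_le/(_ _ eps0)/nbhs_ballP[d /= dpos dP] := w_right tT.
exists (Num.min d d0); first by rewrite lt_min dpos.
split.
  apply: (lifespan_le d0T); first by rewrite addr_gt0 ?lt_min ?dpos//; case: tT.
  by rewrite lerD2l ge_min lexx orbT.
move=> r /andP[tr]; rewrite -ltrBlDl lt_min => /andP[rd _].
have := dP (r - t); rewrite /ball/= sub0r normrN gtr0_norm ?subr_gt0//.
move=> /(_ rd tr); rewrite (addrC t) subrK ler_norml => /andP[? ?].
by apply/andP; split; lra.
Qed.

(** As [w] is bounded on [(0, t)], [al] is locally Lipschitz and small near 0; right continuity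
    gives [w >= w s / 2] just after [s], so the increase is strict. *)
Lemma integral_clock : clock T al.
Proof.
have mono_le s t : lifespan T s -> lifespan T t -> s <= t -> al s <= al t.
  move=> sT tT st; rewrite -subr_ge0 -(mul0r (t - s)) -(mulr0 k); apply: al_ge => //.
  by move=> r /andP[sr rt]; apply/ltW/w0/(lifespan_itv sT tT); rewrite !ltW.
have mono s t : lifespan T s -> lifespan T t -> s < t -> al s < al t.
  move=> sT tT st; have w20 : 0 < w s / 2 by rewrite divr_gt0// w0.
  have [d d0 [dT wd]] := near_w sT w20.
  pose t' := Num.min t (s + d).
  have st' : s < t' by rewrite lt_min st ltrDl.
  have t'T : lifespan T t'.
    by apply: (lifespan_le tT); rewrite ?ge_min ?lexx// (lt_trans sT.1).
  have : k * (w s / 2) * (t' - s) <= al t' - al s.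
    apply: al_ge => //; first exact: ltW.
    move=> r /andP[sr]; rewrite lt_min => /andP[rt rd].
    by have /andP[] : w s - w s / 2 <= w r <= w s + w s / 2 by [apply: wd; rewrite sr|]; lra.
  have : 0 < k * (w s / 2) * (t' - s) by rewrite !mulr_gt0// ?subr_gt0// w0.
  have : al t' <= al t by apply: mono_le => //; rewrite ge_min lexx.
  by lra.
split => //.
- move=> t tT; have [d d0 dT] := lifespan_extend tT; have [B wB] := w_ub dT.
  have B0 : 0 < B.
    by apply: lt_le_trans (w0 tT) (wB _ _); rewrite tT.1 ltrDl.
  have lip a b : lifespan T a -> a <= b -> b <= t + d -> al b - al a <= k * B * (b - a).
    move=> aT ab bd; apply: al_le => //.
      by apply: (lifespan_le dT) bd; exact: lt_le_trans aT.1 ab.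
    by move=> r /andP[ar rb]; rewrite wB// (lt_trans aT.1 ar) (lt_le_trans rb).
  apply/cvgrPdist_le => eps eps0; near=> s.
  have s0 : lifespan T s by near: s; exact: near_lifespan.
  have sd : s < t + d by near: s; apply: lt_nbhsl; rewrite ltrDl.
  have : `|t - s| <= eps / (k * B).
    near: s; apply: cvgr_dist_le; first exact: cvg_id.
    by rewrite divr_gt0// mulr_gt0.
  rewrite ler_pdivlMr ?mulr_gt0//; apply: le_trans; rewrite mulrC.
  have [st|ts] := leP s t.
    rewrite !ger0_norm ?subr_ge0//; last exact: mono_le.
    by apply: lip => //; rewrite lerDl ltW.
  rewrite distrC (distrC t) !gtr0_norm ?subr_gt0//; last exact: mono.
  by apply: lip => //; exact: ltW.
- move=> t tT; have t2T : lifespan T (t / 2).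
    by apply: (lifespan_le tT); rewrite ?divr_gt0 ?tT.1//; have := tT.1; lra.
  apply: le_lt_trans (mono _ _ t2T tT _); last by have := tT.1; lra.
  rewrite mulr_ge0 ?(ltW k0)//; apply: Rintegral_ge0 => r /= r0.
  by apply/ltW/w0/(itv_lifespan t2T).
- move=> eps eps0; have [t tT] := lifespan_gt0 T0; have [B wB] := w_ub tT.
  have t20 : lifespan T (t / 2).
    by apply: (lifespan_le tT); rewrite ?divr_gt0 ?tT.1//; have := tT.1; lra.
  have B0 : 0 < B.
    by apply: lt_le_trans (w0 t20) (wB _ _); have := tT.1; lra.
  pose s := Num.min t (eps / (2 * (k * B))).
  have sT : lifespan T s.
    apply: (lifespan_le tT); last by rewrite ge_min lexx.
    by rewrite lt_min tT.1 divr_gt0// !mulr_gt0.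
  exists s => //; apply: (@le_lt_trans _ _ (k * B * s)).
    apply: al_le0 => // r /andP[r0 rs]; apply: wB; rewrite r0 (lt_le_trans rs)//.
    by rewrite ge_min lexx.
  apply: (@le_lt_trans _ _ (k * B * (eps / (2 * (k * B))))).
    by rewrite ler_pM2l ?mulr_gt0// ge_min lexx orbT.
  rewrite (_ : k * B * (eps / (2 * (k * B))) = eps / 2); last by field; rewrite !gt_eqF.
  by rewrite ltr_pdivrMr// ltr_pMr// ltr1n.
Unshelve. all: by end_near. Qed.

Lemma integral_clock_rderiv t : lifespan T t ->
  (al (t + e) - al t) / e @[e --> (0 : R)^'+] --> k * w t.
Proof.
move=> tT; apply/cvgrPdist_le => eps eps0.
have ek0 : 0 < eps / k by rewrite divr_gt0.
have [d d0 [dT wd]] := near_w tT ek0; near=> e.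
have e0 : 0 < e by near: e; exact: nbhs_right_gt.
have ed : e <= d by near: e; exact: nbhs_right_le.
have eT : lifespan T (t + e).
  by apply: (lifespan_le dT); rewrite ?lerD2l// addr_gt0// tT.1.
have te : t <= t + e by rewrite lerDl ltW.
have ub : al (t + e) - al t <= k * (w t + eps / k) * (t + e - t).
  apply: al_le => // r /andP[tr re].
  by have /wd/andP[] : t < r < t + d by rewrite tr (lt_le_trans re)// lerD2l.
have lb : k * (w t - eps / k) * (t + e - t) <= al (t + e) - al t.
  apply: al_ge => // r /andP[tr re].
  by have /wd/andP[] : t < r < t + d by rewrite tr (lt_le_trans re)// lerD2l.
have ke : k * (eps / k) = eps by rewrite mulrC divfK// gt_eqF.
rewrite ler_distlC ler_pdivrMr// ler_pdivlMr//.
by move: ub lb; rewrite [t + e]addrC addrK mulrDr mulrBr ke => -> ->.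
Unshelve. all: by end_near. Qed.
End primitive.

(** The difference [be - be'] has right derivative 0, hence does not increase. It is below [eps] at
    a point near 0, where [be] is small and [be'] positive. Exchanging the clocks gives equality. *)
Lemma clock_unique T al al' (p : R -> R) : clock T al -> clock T al' ->
  (forall t, lifespan T t -> (al (t + e) - al t) / e @[e --> (0 : R)^'+] --> p t) ->
  (forall t, lifespan T t -> (al' (t + e) - al' t) / e @[e --> (0 : R)^'+] --> p t) ->
  forall t, lifespan T t -> al t = al' t.
Proof.
suff le_clock be be' : clock T be -> clock T be' ->
  (forall t, lifespan T t -> (be (t + e) - be t) / e @[e --> (0 : R)^'+] --> p t) ->
  (forall t, lifespan T t -> (be' (t + e) - be' t) / e @[e --> (0 : R)^'+] --> p t) ->
  forall t, lifespan T t -> be t <= be' t.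
  move=> ca ca' da da' t tT; apply/eqP.
  by rewrite eq_le !le_clock.
move=> cb cb' db db' t tT.
apply/ler_addgt0Pr => eps eps0.
have [a0 a0T ba] := clock_at0 cb eps0.
have aT : lifespan T (Num.min a0 t).
  by apply: (lifespan_le tT); rewrite ?ge_min ?lexx ?orbT// lt_min a0T.1 tT.1.
set a := Num.min a0 t in aT.
have at_ : a <= t by rewrite ge_min lexx orbT.
have baeps : be a < eps.
  by apply: le_lt_trans ba; rewrite (clock_le cb)// ge_min lexx.
have b'a : 0 < be' a by exact: (clock_gt0 cb').
have := @dini_le_increment _ (fun r => be r - be' r) a t 0 at_.
rewrite mul0r => H.
suff : be t - be' t - (be a - be' a) <= 0 by lra.
apply: H => r ar.
  have rT := lifespan_itv aT tT ar.
  by apply: cvgB; [exact: (clock_cont cb rT)|exact: (clock_cont cb' rT)].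
have rT : lifespan T r by apply: (lifespan_itv aT tT); case/andP: ar => -> /ltW.
suff : (be (r + e) - be' (r + e) - (be r - be' r)) / e @[e --> (0 : R)^'+] --> (0 : R).
  by move/(@cvg_dini_le _ (fun r => be r - be' r) r 0).
have H : (be (r + e) - be r) / e - (be' (r + e) - be' r) / e @[e --> (0 : R)^'+] -->
    p r - p r by apply: cvgB; [exact: db|exact: db'].
rewrite subrr in H; apply: cvg_trans H; apply: near_eq_cvg.
by near=> e => /=; rewrite -mulrBl; congr (_ / _); ring.
Unshelve. all: by end_near. Qed.

End integral_clock.

(** * Chain rule and change of time for Dini bounds *)

Section chain_rule.
Context {R : realType}.
Implicit Types (u q : R -> R).

Lemma is_derive_cvg q (x dq : R) : is_derive x 1 q dq ->
  (q (x + h) - q x) / h @[h --> (0 : R)^'] --> dq.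
Proof.
move=> [dqx <-]; move: dqx; rewrite /derivable /derive => dqx.
apply: cvg_trans dqx; apply: near_eq_cvg; near=> h => /=.
by rewrite /GRing.scale/= mulr1 mulrC [h + x]addrC.
Unshelve. all: by end_near. Qed.

(** Since [dq > 0], the quotient of increments is positive near 0 and the bound can be multiplied or
    divided by it, which gives both directions. *)
Lemma dini_le_chain u q (t a dq : R) : u (t + e) @[e --> (0 : R)^'+] --> u t ->
  is_derive (u t) 1 q dq -> 0 < dq ->
  (dini_le u t a -> dini_le (q \o u) t (dq * a)) /\
  (dini_le (q \o u) t a -> dini_le u t (dq^-1 * a)).
Proof.
move=> cu dqu dq0.
(* Where the increment of [u] vanishes, the quotient takes the value [dq], so that [kE] holds for
   every [e] and the limit is still [dq]. *)
pose k e := if u (t + e) == u t then dq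
  else (q (u (t + e)) - q (u t)) / (u (t + e) - u t).
have kE e : q (u (t + e)) - q (u t) = k e * (u (t + e) - u t).
  rewrite /k; case: eqVneq => [->|ne]; first by rewrite !subrr mulr0.
  by rewrite divfK// subr_eq0.
have kdq : k e @[e --> (0 : R)^'+] --> dq.
  apply/cvgrPdist_le => eps eps0.
  have /cvgrPdist_le/(_ _ eps0)/nbhs_ballP[d /= d0 dP] := is_derive_cvg dqu.
  near=> e; rewrite /k; case: eqVneq => [_|ne]; first by rewrite subrr normr0 ltW.
  have := dP (u (t + e) - u t); rewrite (addrC (u t)) subrK; apply.
    by rewrite /ball/= sub0r normrN distrC; near: e; exact: cvgr_dist_lt cu _ d0.
  by rewrite subr_eq0.
have k0 : \forall e \near (0 : R)^'+, 0 < k e by exact: cvgr_gt kdq _ _.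
split=> du.
- apply: (@dini_le_comp_ratio _ (q \o u) _ k) => // eps eps0.
  near=> e => /=; rewrite kE -mulrA ler_pM2l; last by near: e.
  by near: e; exact: du.
- apply: (@dini_le_comp_ratio _ u _ (fun e => (k e)^-1)); rewrite ?invr_gt0//.
    by apply: cvgV => //; exact: lt0r_neq0.
  move=> eps eps0; near=> e.
  have ke0 : 0 < k e by near: e.
  rewrite -mulrA ler_pdivlMl// -kE.
  by near: e; exact: du.
Unshelve. all: by end_near. Qed.

Lemma dini_le_time_change u (phi : R -> R) (s p a : R) : 0 < p ->
  {for s, continuous phi} -> (\forall e \near (0 : R)^'+, phi s < phi (s + e)) ->
  (phi (s + e) - phi s) / e @[e --> (0 : R)^'+] --> p ->
  dini_le u (phi s) a -> dini_le (u \o phi) s (p * a).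
Proof.
move=> p0 cphi incr phip du.
apply: (@dini_le_comp_ratio _ (u \o phi) _ (fun e => (phi (s + e) - phi s) / e)) => // eps eps0.
have H := cvg_at_right_increment cphi incr (du _ eps0).
near=> e => /=; have e0 : 0 < e by near: e; exact: nbhs_right_gt.
rewrite mulrAC divfK ?gt_eqF// mulrC.
rewrite -[X in u X - _](subrK (phi s)) (addrC (_ - _)).
by near: e.
Unshelve. all: by end_near. Qed.

End chain_rule.

(** * Trigonometric estimates *)

Section trig.
Context {R : realType}.
Implicit Types x : R.

Lemma sin_le_id x : 0 <= x -> sin x <= x.
Proof.
move=> x0; have [|c _] := @MVT_segment _ (@sin R) cos 0 x x0.
  by apply: continuous_subspaceT; exact: continuous_sin.
rewrite sin0 !subr0 => ->; rewrite ler_piMl//; exact: cos_le1.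
Qed.

Lemma cos_half x : cos x = 1 - 2 * sin (x / 2) ^+ 2.
Proof.
rewrite {1}(_ : x = (x / 2) *+ 2); last by rewrite -mulr_natr divfK.
by rewrite cos_mulr2n cos2sin2; ring.
Qed.

Lemma one_sub_cos_le x : 0 <= x -> x <= pi -> 1 - cos x <= x ^+ 2 / 2.
Proof.
move=> x0 xpi; have h0 : 0 <= sin (x / 2).
  by apply: sin_ge0_pi; have := @pi_gt0 R; lra.
have : sin (x / 2) <= x / 2 by apply: sin_le_id; lra.
by rewrite cos_half; nra.
Qed.

(** Mean value theorem, with [cos] above one half near 0. It serves where the distance vanishes and
    the chain rule has no positive factor. *)
Lemma id_le_sin2 : \forall x \near (0 : R), 0 <= x -> x <= 2 * sin x.
Proof.
have cos_ge : \forall x \near (0 : R), 1 / 2 < cos x.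
  have := @continuous_cos R 0; rewrite /continuous_at cos0 => /cvgr_gt; apply.
  by rewrite ltr_pdivrMr// mul1r ltr1n.
have /nbhs_ballP[d /= d0 dcos] := cos_ge.
near=> x => x0; have [|c] := @MVT_segment _ (@sin R) cos 0 x x0.
  by apply: continuous_subspaceT; exact: continuous_sin.
rewrite in_itv/= sin0 !subr0 => /andP[c0 cx] ->.
have : 1 / 2 < cos c.
  apply: dcos; rewrite /ball/= sub0r normrN ger0_norm// (le_lt_trans cx)//.
  by near: x; exact: lt_nbhsl.
by nra.
Unshelve. all: by end_near. Qed.

(** For [om = Num.sqrt (K / N)] the function is [s_ K N (r / 2) ^+ 2], whose derivative is half of
    [s_ K N r] by the double angle formula. *)
Lemma is_derive_half_sin2 (om x : R) : om != 0 ->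
  is_derive x 1 (fun r => (sin (r / 2 * om) / om) ^+ 2) (sin (x * om) / om / 2).
Proof.
move=> om0.
apply: is_derive_eq; rewrite /GRing.scale/=.
rewrite [in RHS](_ : x * om = (x / 2 * om) *+ 2); last first.
  by rewrite -mulr_natr mulrAC divfK.
by rewrite sin_mulr2n -mulr_natr; field.
Qed.

Lemma is_derive_half_sq (x : R) : is_derive x 1 (fun r => r ^+ 2 / 2) x.
Proof.
by apply: is_derive_eq; rewrite /GRing.scale/=; field.
Qed.

End trig.

(** * Discrete convexity *)

Section discrete.
Context {R : realType}.

(** By convexity each increment [b k.+1 - b k] is at least the first one, and the increments
    telescope. *)
Lemma discrete_convex_slope (b : nat -> R) n :
  (forall k, (0 < k < n)%N -> 2 * b k <= b k.-1 + b k.+1) ->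
  n%:R * (b 1%N - b 0%N) <= b n - b 0%N.
Proof.
move=> cvx; have slope k : (k < n)%N -> b 1%N - b 0%N <= b k.+1 - b k.
  elim: k => [//|k IH kn]; have := IH (ltnW kn); have := cvx k.+1.
  by rewrite kn/= => /(_ isT); lra.
have : forall k, (k <= n)%N -> k%:R * (b 1%N - b 0%N) <= b k - b 0%N.
  elim=> [_|k IH kn]; first by rewrite mul0r subrr.
  by have := IH (ltnW kn); have := slope _ kn; rewrite -natr1; lra.
by apply.
Qed.

End discrete.

(** * Midpoints and chains under (K,N)-convexity *)

Section geometry.
Context {R : realType} {X : metricType R}.
Variables (F : X -> R) (C om : R).
Hypotheses (F0 : forall x, 0 <= F x) (FC : forall x, F x <= C) (om0 : 0 < om).
Hypothesis X_intrinsic : strictly_intrinsic X.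
Hypothesis F_convex : forall x0 x1 : X, 0 < mdist x0 x1 -> mdist x0 x1 * om < pi ->
  exists2 g : R -> X, geodesic x0 x1 g & forall t : R, 0 <= t <= 1 ->
    F (g t) * sin (mdist x0 x1 * om) <=
      sin ((1 - t) * mdist x0 x1 * om) * F x0 + sin (t * mdist x0 x1 * om) * F x1.

(* The factor [cos th] of [F m] is removed using [F m <= C]. *)
Lemma midpoint_convex x0 x1 D : mdist x0 x1 <= D -> D * om < pi ->
  exists m, [/\ mdist x0 m = mdist x0 x1 / 2, mdist m x1 = mdist x0 x1 / 2 &
    2 * F m <= F x0 + F x1 + C * om ^+ 2 * D ^+ 2 / 4].
Proof.
set d := mdist x0 x1 => dD Dpi; have C0 : 0 <= C by rewrite (le_trans (F0 x0)).
have d_ge0 : 0 <= d by exact: mdist_ge0.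
have D0 : 0 <= D by rewrite (le_trans d_ge0).
move: (mdist_ge0 x0 x1); rewrite -/d le_eqVlt => /predU1P[d0|d0].
  have x01 : x0 = x1 by apply: mdist_positivity; rewrite -/d -d0.
  exists x0; rewrite -d0 mul0r /d -x01 mdistxx; split => //.
  by rewrite mulr_natl mulr2n lerDl divr_ge0// mulr_ge0 ?sqr_ge0// mulr_ge0 ?sqr_ge0.
have dpi : d * om < pi by rewrite (le_lt_trans _ Dpi)// ler_wpM2r// ltW.
have [g [g0 g1 _ gd] gF] := F_convex d0 dpi.
have h01 : 0 <= (2^-1 : R) <= 1 by apply/andP; split; lra.
have i0 : 0 <= (0 : R) <= 1 by rewrite lexx ler01.
have i1 : 0 <= (1 : R) <= 1 by rewrite lexx ler01.
have d1 := gd _ _ i0 h01; have d2 := gd _ _ h01 i1.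
rewrite g0 g1 subr0 ger0_norm ?invr_ge0 ?ler0n// in d1.
rewrite g0 g1 ger0_norm ?subr_ge0 ?(andP h01).2// in d2.
exists (g 2^-1); split; [by rewrite d1 mulrC|by rewrite d2 -/d; lra|].
have := gF _ h01; set m := g _; set th := d * om / 2.
have -> : (1 - 2^-1) * mdist x0 x1 * om = th by rewrite /th -/d; lra.
have -> : 2^-1 * mdist x0 x1 * om = th by rewrite /th -/d; lra.
have -> : mdist x0 x1 * om = th *+ 2 by rewrite /th -mulr_natr divfK.
have th0 : 0 < th by rewrite /th divr_gt0// mulr_gt0.
have thpi : th < pi by rewrite /th; have := @pi_gt0 R; lra.
have sth : 0 < sin th by rewrite sin_gt0_pi// th0.
rewrite sin_mulr2n -mulrDr => H.
(* The sine of the full angle is [2 * sin th * cos th]; division by [sin th] leaves [cos th]. *)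
have {H} : 2 * F m * cos th <= F x0 + F x1.
  rewrite -(ler_pM2l sth); apply: le_trans H.
  by rewrite -(mulr_natl (_ * _)) le_eqVlt; apply/orP; left; apply/eqP; ring.
have := one_sub_cos_le (ltW th0) (ltW thpi).
have thD : th ^+ 2 <= om ^+ 2 * D ^+ 2 / 4.
  have : d * om <= D * om by rewrite ler_pM2r.
  have := mulr_ge0 d_ge0 (ltW om0).
  by rewrite /th -exprMn; nra.
have := FC m; have := F0 m; have := cos_le1 th.
move=> c1 Fm0 FmC c2 H.
have : 2 * F m * (1 - cos th) <= 2 * C * (th ^+ 2 / 2).
  by apply: ler_pM => //; rewrite ?subr_ge0 ?mulr_ge0 ?ler_pM2l.
have : C * th ^+ 2 <= C * (om ^+ 2 * D ^+ 2 / 4) by exact: ler_wpM2l.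
by lra.
Qed.

(* A chain minimizing [\sum_k F (x k)] up to [eps] among the chains of [n]
   steps of length at most [mdist x z / n] is convex up to [eps], as otherwise
   one of its points could be replaced with the midpoint of its neighbours. *)
Lemma chain_convex x z n eta : (0 < n)%N -> 0 < eta ->
  2 * (mdist x z / n%:R) * om < pi ->
  exists x1, [/\ mdist x x1 <= mdist x z / n%:R,
    mdist x1 z <= mdist x z - mdist x z / n%:R &
    n%:R * (F x1 - F x) <= F z - F x + C * om ^+ 2 * mdist x z ^+ 2 / 2 + eta].
Proof.
set L := mdist x z => n0 eta0; set l := L / n%:R => lpi.
have nR0 : 0 < n%:R :> R by rewrite ltr0n.
pose chain (c : nat -> X) := [/\ c 0%N = x, c n = z &
  forall k, (k < n)%N -> mdist (c k) (c k.+1) <= l].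
pose S := [set \sum_(k < n.+1) F (c k) | c in chain].
have supS : has_inf S.
  split; last by exists 0 => _ [c _ <-]; apply: sumr_ge0.
  (* A geodesic sampled at the times [k / n] is a chain, so [S] is nonempty. *)
  have [g [g0 g1 _ gd]] := X_intrinsic x z.
  exists (\sum_(k < n.+1) F (g (k%:R / n%:R))); exists (fun k => g (k%:R / n%:R)) => //.
  split; rewrite ?mul0r ?divff ?lt0r_neq0//.
  move=> k kn; rewrite gd.
  - rewrite g0 g1 -/L -mulrBl -natrB// subSnn ger0_norm ?divr_ge0//.
    by rewrite /l mulrC mul1r.
  - by rewrite divr_ge0//= ler_pdivrMr// mul1r ler_nat ltnW.
  - by rewrite divr_ge0//= ler_pdivrMr// mul1r ler_nat.
(* Divided by the square of [n] because the quadratic correction below multiplies it by that square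
   at the end of the chain. *)
have e0 : 0 < eta / n%:R ^+ 2 by rewrite divr_gt0// exprn_gt0.
set e := eta / n%:R ^+ 2 in e0.
have [_ [c [c0 cn cl] <-] clt] := inf_adherent e0 supS.
have mid k : (0 < k < n)%N ->
    2 * F (c k) <= F (c k.-1) + F (c k.+1) + C * om ^+ 2 * l ^+ 2 + 2 * e.
  move=> /andP[k0 kn].
  have km : (k.-1 < n)%N by rewrite (leq_ltn_trans (leq_pred _)).
  have dk : mdist (c k.-1) (c k.+1) <= 2 * l.
    have := cl _ km; rewrite prednK// => ?; have := cl _ kn => ?.
    by have := metric_triangle (c k.-1) (c k) (c k.+1); lra.
  (* The neighbours of [c k] are at most [2 * l] apart, so [m] is within [l] of both and [c'] is
     again a chain. *)
  have [m [dm1 dm2 Fm]] := midpoint_convex dk lpi.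
  pose c' j := if j == k then m else c j.
  have c'S : S (\sum_(j < n.+1) F (c' j)).
    exists c' => //; split; rewrite /c'.
    - by rewrite eq_sym gtn_eqF.
    - by rewrite gtn_eqF.
    move=> j jn; case: eqVneq => [->|jk].
      by rewrite gtn_eqF// dm2; lra.
    case: eqVneq => [jk'|_]; last exact: cl.
    have -> : j = k.-1 by rewrite -jk'.
    by rewrite dm1; lra.
  have := ge_inf supS.2 c'S.
  have kn1 : (k < n.+1)%N by rewrite ltnW.
  move: clt; rewrite (bigD1 (Ordinal kn1))//= => clt.
  rewrite (bigD1 (Ordinal kn1))//= {1}/c' eqxx.
  rewrite (eq_bigr (fun j : 'I_n.+1 => F (c j))); last first.
    by move=> j jk; rewrite /c' -val_eqE/= in jk *; rewrite (negbTE jk).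
  by move: clt; lra.
have n1 : (1 <= n)%N by [].
exists (c 1%N); split.
- by rewrite -c0 cl.
- have far k : (k < n)%N -> mdist (c 1%N) (c k.+1) <= k%:R * l.
    elim: k => [_|k IH kn]; first by rewrite mdistxx mul0r.
    have := IH (ltnW kn); have := cl _ kn.
    by have := metric_triangle (c 1%N) (c k.+1) (c k.+2); rewrite -natr1; lra.
  have := far n.-1; rewrite prednK// leqnn cn => /(_ isT).
  rewrite -subn1 natrB// mulrBl mul1r.
  by rewrite {1}/l mulrC divfK// gt_eqF.
(* The added multiple of [k ^+ 2] has second difference [C * om ^+ 2 * l ^+ 2 + 2 * e], exactly the
   defect in [mid], which makes the sequence convex. *)
have := @discrete_convex_slope _ (fun k => F (c k) + (C * om ^+ 2 * l ^+ 2 / 2 + e) * k%:R ^+ 2) n.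
rewrite c0 cn /=; set A := _ / 2 + e => H.
have {H} : n%:R * (F (c 1%N) + A * 1 ^+ 2 - (F x + A * 0 ^+ 2)) <=
    F z + A * n%:R ^+ 2 - (F x + A * 0 ^+ 2).
  apply: H => k kn; have := mid _ kn; case: k kn => // k kn /=.
  by rewrite -!natr1 /A; nra.
rewrite expr1n expr0n/= mulr0 mulr1 !addr0 => H.
have An : A * n%:R ^+ 2 = C * om ^+ 2 * L ^+ 2 / 2 + eta.
  by rewrite /A /l /e; field; rewrite gt_eqF.
have A0 : 0 <= n%:R * A.
  have C0 : 0 <= C by rewrite (le_trans (F0 x)).
  have : 0 <= C * om ^+ 2 * l ^+ 2 by rewrite mulr_ge0 ?sqr_ge0// mulr_ge0 ?sqr_ge0.
  by move=> ?; apply: mulr_ge0 => //; rewrite /A; lra.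
by move: H; rewrite An; lra.
Qed.

End geometry.

(** * Equivalence of the two conditions at a point of the curve *)

Section local_to_global.
Context {R : realType} {X : metricType R}.
Variables (F : X -> R) (C om : R).
Hypotheses (F0 : forall x, 0 <= F x) (FC : forall x, F x <= C) (om0 : 0 < om).
Hypothesis X_intrinsic : strictly_intrinsic X.
Hypothesis F_convex : forall x0 x1 : X, 0 < mdist x0 x1 -> mdist x0 x1 * om < pi ->
  exists2 g : R -> X, geodesic x0 x1 g & forall t : R, 0 <= t <= 1 ->
    F (g t) * sin (mdist x0 x1 * om) <=
      sin ((1 - t) * mdist x0 x1 * om) * F x0 + sin (t * mdist x0 x1 * om) * F x1.
Variables (u : R -> X) (s : R).
Hypothesis cu : u (s + e) @[e --> (0 : R)^'+] --> u s.

Let cvg_mdist z : mdist (u (s + e)) z @[e --> (0 : R)^'+] --> mdist (u s) z.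
Proof.
apply/cvgrPdist_lt => eps eps0.
have : \forall e \near (0 : R)^'+, ball (u s) eps (u (s + e)).
  by apply: cu; exact: nbhsx_ballx.
apply: filterS => e; rewrite ballEmdist /= => d.
have := metric_triangle (u s) (u (s + e)) z.
have := metric_triangle (u (s + e)) (u s) z.
rewrite (metric_sym (u (s + e)) (u s)) => ? ?.
by rewrite ltr_norml; apply/andP; split; lra.
Qed.

(** The sum [mdist (u r) x + mdist x z] bounds [mdist (u r) z] from above and equals it at
    [r = s]. *)
Let dini_triangle x z a : mdist (u s) x + mdist x z <= mdist (u s) z ->
  dini_le (fun r => mdist (u r) x) s a -> dini_le (fun r => mdist (u r) z) s a.
Proof.
move=> btw; apply: le_dini_le; near=> e.
by have := metric_triangle (u (s + e)) x z; lra.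
Unshelve. all: by end_near. Qed.

Let dini_sin x a : 0 < mdist (u s) x -> mdist (u s) x * om < pi ->
  let dq := sin (mdist (u s) x * om) / om / 2 in
  (dini_le (fun r => mdist (u r) x) s a ->
     dini_le (fun r => (sin (mdist (u r) x / 2 * om) / om) ^+ 2) s (dq * a)) /\
  (dini_le (fun r => (sin (mdist (u r) x / 2 * om) / om) ^+ 2) s a ->
     dini_le (fun r => mdist (u r) x) s (dq^-1 * a)).
Proof.
move=> d0 dpi /=.
apply: (@dini_le_chain _ (fun r => mdist (u r) x) (fun r => (sin (r / 2 * om) / om) ^+ 2)).
- exact: (@cvg_mdist x).
- by apply: is_derive_half_sin2; rewrite gt_eqF.
- by rewrite !divr_gt0// sin_gt0_pi// dpi mulr_gt0.
Qed.

Let dini_sq x a : 0 < mdist (u s) x ->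
  (dini_le (fun r => mdist (u r) x) s a ->
     dini_le (fun r => mdist (u r) x ^+ 2 / 2) s (mdist (u s) x * a)) /\
  (dini_le (fun r => mdist (u r) x ^+ 2 / 2) s a ->
     dini_le (fun r => mdist (u r) x) s ((mdist (u s) x)^-1 * a)).
Proof.
move=> d0.
apply: (@dini_le_chain _ (fun r => mdist (u r) x) (fun r => r ^+ 2 / 2)) => //.
exact: is_derive_half_sq.
Qed.

(** Both this condition and [lambda_at] are expressed in the time of the EVI for [f_N]; the factor
    [F (u s)] in the last term comes from that change of time. *)
Definition KN_at := forall x, mdist (u s) x * om < pi ->
  dini_le (fun r => (sin (mdist (u r) x / 2 * om) / om) ^+ 2) s
    ((F x - F (u s)) / 2 + om ^+ 2 * F (u s) * (sin (mdist (u s) x / 2 * om) / om) ^+ 2).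

Definition lambda_at := forall z,
  dini_le (fun r => mdist (u r) z ^+ 2 / 2) s
    (F z - F (u s) + C * om ^+ 2 / 2 * mdist (u s) z ^+ 2).

Let dist0 x : mdist (u s) x = 0 -> x = u s.
Proof. by move/mdist_positivity. Qed.

Let sin_sq_le (d : R) : 0 <= d -> d / 2 * om < pi -> (sin (d / 2 * om) / om) ^+ 2 <= d ^+ 2 / 4.
Proof.
move=> d0 dpi; have h0 : 0 <= d / 2 * om by rewrite mulr_ge0 ?divr_ge0// ltW.
rewrite (_ : d ^+ 2 / 4 = (d / 2) ^+ 2); last by field.
rewrite ler_sqr ?nnegrE ?divr_ge0 ?(ltW om0)//; last by rewrite sin_ge0_pi// h0 ltW.
by rewrite ler_pdivrMr// sin_le_id.
Qed.

(** For [z = u s] both squared functions have derivative 0 in the distance, so the chain rule fails.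
    A comparison up to a factor suffices, as the bound to be transferred is 0. *)
Let sin_sq_near0 z : mdist (u s) z = 0 ->
  \forall e \near (0 : R)^'+, mdist (u (s + e)) z / 2 * om < pi /\
   mdist (u (s + e)) z ^+ 2 / 2 <= 8 * (sin (mdist (u (s + e)) z / 2 * om) / om) ^+ 2.
Proof.
move=> dz.
have h0 : mdist (u (s + e)) z / 2 * om @[e --> (0 : R)^'+] --> (0 : R).
  have : mdist (u (s + e)) z / 2 * om @[e --> (0 : R)^'+] --> mdist (u s) z / 2 * om.
    by do 2 apply: cvgMl; exact: (@cvg_mdist z).
  by rewrite dz !mul0r.
have small := h0 _ (@id_le_sin2 R).
near=> e; split.
  by near: e; apply: cvgr_lt h0 _ _; exact: pi_gt0.
set d := mdist (u (s + e)) z.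
have d0 : 0 <= d by exact: mdist_ge0.
have th0 : 0 <= d / 2 * om by rewrite mulr_ge0 ?divr_ge0// ltW.
have : d / 2 * om <= 2 * sin (d / 2 * om).
  by move: th0; rewrite /d; near: e; exact: small.
move: (sin _) => S dS.
have dS' : d / 2 <= 2 * (S / om) by rewrite mulrA ler_pdivlMr.
by nra.
Unshelve. all: by end_near. Qed.

Lemma lambda_at_of_KN_at : KN_at -> lambda_at.
Proof.
move=> KN z; have C0 : 0 <= C by rewrite (le_trans (F0 z)).
have := mdist_ge0 (u s) z; rewrite le_eqVlt => /predU1P[/esym L0|].
  have zE := dist0 L0.
  have := KN z; rewrite L0 mul0r => /(_ (pi_gt0 R)).
  rewrite zE subrr !mul0r sin0 mul0r expr0n/= mulr0 addr0 mulr0 addr0 -zE => du.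
  move=> eps eps0; have e80 : 0 < eps / 8 by rewrite divr_gt0.
  have := du _ e80; rewrite L0 !mul0r sin0 mul0r expr0n/= => du'.
  near=> e; rewrite mul0r subr0.
  apply: (@le_trans _ _ (8 * (sin (mdist (u (s + e)) z / 2 * om) / om) ^+ 2)).
    by near: e; apply: filterS (sin_sq_near0 L0) => e [].
  have : (sin (mdist (u (s + e)) z / 2 * om) / om) ^+ 2 - 0 <= (0 + eps / 8) * e by near: e.
  by lra.
set L := mdist (u s) z; set y := u s => L0.
set Lam := F z - F y + C * om ^+ 2 / 2 * L ^+ 2.
pose h n : R := L / n.+1%:R.
have h_cvg : h n * om @[n --> \oo] --> (0 : R).
  rewrite -(mul0r om); apply: cvgMl; rewrite -(mulr0 L); apply: cvgMr.
  exact: cvg_harmonic.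
(* [rho n] is the factor [th / sin th] left by the passage from the squared sine to the distance; it
   tends to 1, so [B n] tends to [Lam]. *)
pose rho n : R := h n * om / sin (h n * om).
pose B n : R := rho n * (Lam + n.+1%:R^-1 + C * om ^+ 2 * L ^+ 2 / 2 * n.+1%:R^-1).
have hpos n : 0 < h n * om by rewrite mulr_gt0// divr_gt0.
apply: (@dini_le_cvg _ _ _ _ \oo _ B).
  rewrite -[X in _ --> X]mul1r; apply: cvgM.
    rewrite /rho -[1]invr1 -(@cos0 R).
    have H : ((sin (0 + h n * om) - sin 0) / (h n * om))^-1 @[n --> \oo] --> (cos (0 : R))^-1.
      apply: cvgV; first by rewrite cos0 oner_eq0.
      have dn : h n * om @[n --> \oo] --> (0 : R)^'.
        move=> A /= /nbhs_ballP[d /= d0 dA].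
        have /cvgrPdist_lt/(_ _ d0) := h_cvg; apply: filterS => n dn.
        by apply: dA => //=; rewrite gt_eqF.
      exact: (cvg_comp _ _ dn (is_derive_cvg (@is_derive_sin R 0))).
    apply: cvg_trans H; apply: near_eq_cvg; near=> n.
    by rewrite add0r sin0 subr0 invf_div.
  rewrite -[X in _ --> X]addr0 -[X in X + _]addr0; apply: cvgD.
    by apply: cvgD; [exact: cvg_cst|exact: cvg_harmonic].
  by rewrite -(mulr0 (C * om ^+ 2 * L ^+ 2 / 2)); apply: cvgMr; exact: cvg_harmonic.
near=> n.
have hpi : 2 * h n * om < pi.
  have : h n * om < pi / 2 by near: n; apply: cvgr_lt h_cvg _ _; rewrite divr_gt0 ?pi_gt0.
  by lra.
(* A chain of [n.+1] steps, with a tolerance that vanishes in the limit; [hpi] makes convexity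
   applicable to points two steps apart. *)
have [//|x1 [d1 d2 Fx1]] := @chain_convex _ _ _ _ _ F0 FC om0 X_intrinsic F_convex
  y z n.+1 n.+1%:R^-1 isT _ hpi.
have n0 : 0 < n.+1%:R :> R by [].
(* The two bounds force equality in the triangle inequality: [x1] lies between [y] and [z] at
   distance [h n] from [y]. *)
have dh : mdist y x1 = h n.
  apply/eqP; rewrite eq_le d1/=.
  by have := metric_triangle y x1 z; rewrite -/L; move: d2; rewrite -/L -/(h n); lra.
have x1pi : mdist y x1 * om < pi by have := hpos n; rewrite dh; lra.
have h0 : 0 < h n by rewrite divr_gt0.
have shn : 0 < sin (h n * om) by rewrite sin_gt0_pi// hpos -dh.
(* From the squared sine at [x1] to the distance to [x1], then to the distance to [z], and finally
   to its square. *)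
have := KN x1 x1pi => /(@dini_sin x1 _ _ x1pi).2; rewrite -/y dh => /(_ h0) du.
have {du} := @dini_triangle x1 z _ _ du; rewrite -/y dh -/L => du.
have : h n + mdist x1 z <= L by move: d2; rewrite -/L -/(h n); lra.
move=> /du /(@dini_sq z _ L0).1; apply: dini_le_weaken; rewrite -/y -/L.
rewrite (_ : L * _ = rho n * (n.+1%:R * (F x1 - F y) +
    2 * n.+1%:R * om ^+ 2 * F y * (sin (h n / 2 * om) / om) ^+ 2)); last first.
  rewrite /rho; have -> : L = h n * n.+1%:R by rewrite /h divfK// gt_eqF.
  by field; rewrite !gt_eqF.
rewrite /B ler_pM2l; last by rewrite divr_gt0.
have hE : n.+1%:R * h n ^+ 2 = L ^+ 2 * n.+1%:R^-1.
  by rewrite /h; field; rewrite gt_eqF.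
(* The last term of [KN_at] is of order [h n ^+ 2]: even multiplied by [n.+1] it vanishes in the
   limit. *)
have : n.+1%:R * om ^+ 2 * F y * (sin (h n / 2 * om) / om) ^+ 2 <=
    n.+1%:R * om ^+ 2 * C * (h n ^+ 2 / 4).
  apply: ler_pM; rewrite ?sqr_ge0//.
  - by rewrite !mulr_ge0// ltW.
  - by rewrite ler_pM2l// mulr_gt0// exprn_gt0.
  - by apply: sin_sq_le; [exact: ltW|have := hpos n; lra].
have -> : n.+1%:R * om ^+ 2 * C * (h n ^+ 2 / 4) = C * om ^+ 2 * L ^+ 2 * n.+1%:R^-1 / 4.
  by rewrite -(mulrA _ (L ^+ 2)) -hE; ring.
move: Fx1; rewrite -/L /Lam; move: (n.+1%:R^-1) (sin _ / om) => i S; lra.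
Unshelve. all: by end_near. Qed.

Lemma KN_at_of_lambda_at : lambda_at -> KN_at.
Proof.
move=> lam z Lpi; have C0 : 0 <= C by rewrite (le_trans (F0 z)).
have := mdist_ge0 (u s) z; rewrite le_eqVlt => /predU1P[/esym L0|].
  have zE := dist0 L0.
  have := lam z; rewrite L0 -zE subrr expr0n/= mulr0 addr0 => du.
  rewrite !mul0r sin0 mul0r expr0n/= mulr0 addr0 => eps eps0.
  have := du _ eps0; rewrite L0 expr0n/= mul0r => du'.
  near=> e; rewrite !mul0r sin0 mul0r expr0n/= subr0.
  apply: (@le_trans _ _ (mdist (u (s + e)) z ^+ 2 / 2 - 0)); last by near: e.
  have [+ _] : mdist (u (s + e)) z / 2 * om < pi /\
   mdist (u (s + e)) z ^+ 2 / 2 <= 8 * (sin (mdist (u (s + e)) z / 2 * om) / om) ^+ 2.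
    by near: e; exact: sin_sq_near0.
  move=> /(sin_sq_le (mdist_ge0 _ _)); have := sqr_ge0 (mdist (u (s + e)) z).
  by lra.
move: Lpi; set L := mdist (u s) z; set y := u s => Lpi L0.
have [g [g0 g1 _ gd] gF] := F_convex L0 Lpi.
have sL : 0 < sin (L * om) by rewrite sin_gt0_pi// Lpi mulr_gt0.
(* The right-hand side of the convexity inequality along [g]. As [Psi 0] is [sin (L * om) * F y],
   the slope of [Psi] at 0 controls that of [F] along [g]. *)
pose Psi t := sin ((1 - t) * L * om) * F y + sin (t * L * om) * F z.
have dPsi : is_derive (0 : R) 1 Psi (L * om * (F z - cos (L * om) * F y)).
  apply: is_derive_eq; rewrite /GRing.scale/=.
  by rewrite subr0 !mul1r !mul0r cos0; ring.
(* The bound obtained from the point [g t]. The constant [C] enters through a term of order [t], so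
   it disappears in the limit. *)
pose B t :=
  ((Psi (0 + t) - Psi 0) / t + sin (L * om) * C * om ^+ 2 / 2 * L ^+ 2 * t) / (2 * L * om).
apply: (@dini_le_cvg _ _ _ _ (0 : R)^'+ _ B).
  (* The limit is the bound of [KN_at] because [1 - cos (L * om)] is twice the squared sine of the
     half angle. *)
  have -> : (F z - F y) / 2 + om ^+ 2 * F y * (sin (L / 2 * om) / om) ^+ 2 =
      (L * om * (F z - cos (L * om) * F y) +
       sin (L * om) * C * om ^+ 2 / 2 * L ^+ 2 * 0) / (2 * L * om).
    rewrite cos_half (_ : L * om / 2 = L / 2 * om); last by rewrite mulrAC.
    by field; rewrite !gt_eqF.
  apply: cvgMl; apply: cvgD; last by apply: cvgMr; exact: cvg_at_right_filter.
  by apply: cvg_dnbhs_at_right; exact: is_derive_cvg dPsi.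
near=> t; have t0 : 0 < t by near: t; exact: nbhs_right_gt.
have t1 : t < 1 by near: t; apply: nbhs_right_lt.
have t01 : 0 <= t <= 1 by rewrite !ltW.
have i0 : 0 <= (0 : R) <= 1 by rewrite lexx ler01.
have i1 : 0 <= (1 : R) <= 1 by rewrite lexx ler01.
have dyt := gd _ _ i0 t01; rewrite g0 g1 subr0 gtr0_norm// -/L in dyt.
have dtz := gd _ _ t01 i1; rewrite g0 g1 gtr0_norm ?subr_gt0// -/L in dtz.
have tL0 : 0 < t * L by rewrite mulr_gt0.
have := lam (g t) => /(@dini_sq (g t) _ _).2; rewrite -/y dyt => /(_ tL0).
move=> /(@dini_triangle (g t) z); rewrite -/y dyt dtz -/L -mulrDl addrC subrK mul1r.
move=> /(_ (lexx _)) /(@dini_sin z _ L0 Lpi).1; apply: dini_le_weaken; rewrite -/y -/L.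
have := gF t t01; rewrite -/L -/y => gt.
have -> : sin (L * om) / om / 2 *
    ((t * L)^-1 * (F (g t) - F y + C * om ^+ 2 / 2 * (t * L) ^+ 2)) =
   ((F (g t) * sin (L * om) - sin (L * om) * F y) / t + sin (L * om) * C * om ^+ 2 / 2 * L ^+ 2 * t)
     / (2 * L * om).
  by field; rewrite !gt_eqF.
rewrite /B ler_pM2r ?invr_gt0 ?mulr_gt0// lerD2r ler_pM2r ?invr_gt0//.
rewrite add0r /Psi subr0 mul1r !mul0r sin0 mul0r addr0.
by lra.
Unshelve. all: by end_near. Qed.

End local_to_global.

(** * The functional [f_N] as a bounded real function *)

Section exp_functional_facts.
Context {R : realType} {X : metricType R}.
Variables (f : X -> \bar R) (M N : R).
Hypotheses (f_le : forall x, (f x <= M%:E)%E) (N0 : N < 0).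

Definition expf x : R := fine (exp_functional N f x).

Let Ni : 0 < - N^-1. Proof. by rewrite oppr_gt0 invr_lt0. Qed.

Lemma domain_star_bounded x : domain_star f x.
Proof. by rewrite /domain_star/= (le_lt_trans (f_le x))// ltry. Qed.

Lemma exp_functionalE x : exp_functional N f x = (expf x)%:E.
Proof.
rewrite /expf /exp_functional; have := f_le x; case: (f x) => [r||] // _.
by rewrite gt0_muleNy// lte_fin.
Qed.

Lemma expf_ge0 x : 0 <= expf x.
Proof. by rewrite fine_ge0// expeR_ge0. Qed.

Lemma le_exp_functional x y : (exp_functional N f x <= exp_functional N f y)%E = (f x <= f y)%E.
Proof. by rewrite lee_expeR lee_pmul2l// lte_fin. Qed.

Lemma le_expf x y : (expf x <= expf y) = (f x <= f y)%E.
Proof. by rewrite -lee_fin -!exp_functionalE le_exp_functional. Qed.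

Lemma expf_le x : expf x <= expR (- M / N).
Proof.
rewrite -lee_fin -exp_functionalE (_ : (expR _)%:E = expeR ((- N^-1)%:E * M%:E)); last first.
  by rewrite /= mulrC !(mulrN, mulNr).
by rewrite lee_expeR lee_pmul2l// lte_fin.
Qed.

Lemma expf_gt0 x : domain f x -> 0 < expf x.
Proof.
rewrite /domain/= /expf /exp_functional; case: (f x) => [r||] // _.
by rewrite /= expR_gt0.
Qed.

Lemma expf_lsc (f_lsc : lower_semicontinuous f) x a : a < expf x ->
  \forall y \near x, a < expf y.
Proof.
move=> ax; have [a0|a0] := ltP a 0.
  by near=> y; rewrite (lt_le_trans a0)// expf_ge0.
(* As [a] may be 0, the positive [b] between [a] and [expf x] is used instead: its logarithm gives a
   real level of [f]. *)
pose b := (a + expf x) / 2.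
have b0 : 0 < b by rewrite /b; lra.
have ab : a < b by rewrite /b; lra.
have bx : b < expf x by rewrite /b; lra.
have bE : b%:E = expeR ((- N^-1)%:E * (- N * ln b)%:E).
  by rewrite -EFinM mulrA mulrNN mulVf ?lt_eqF// mul1r /= lnK.
have [|V Vx fV] := f_lsc x (- N * ln b).
  have : (b%:E < exp_functional N f x)%E by rewrite exp_functionalE lte_fin.
  by rewrite bE lte_expeR lte_pmul2l// lte_fin.
near=> y; rewrite (lt_trans ab)// -lte_fin -exp_functionalE bE lte_expeR.
rewrite lte_pmul2l ?lte_fin//; apply: fV.
by near: y.
Unshelve. all: by end_near. Qed.

End exp_functional_facts.

(** * Constants and convexity in real form *)

Section KN_facts.
Context {R : realType} {X : metricType R}.
Variables (f : X -> \bar R) (M K N : R).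
Hypotheses (f_le : forall x, (f x <= M%:E)%E) (K0 : K < 0) (N0 : N < 0).
Let om := Num.sqrt (K / N).
Let F := expf f N.

Lemma KN_gt0 : 0 < K / N. Proof. by rewrite nmulr_rgt0 ?invr_lt0. Qed.

Lemma om_gt0 : 0 < om. Proof. by rewrite sqrtr_gt0 KN_gt0. Qed.

Lemma om_sq : om ^+ 2 = K / N. Proof. by rewrite sqr_sqrtr// ltW// KN_gt0. Qed.

Lemma lt_threshold d : (d < threshold K N) = (d * om < pi).
Proof.
rewrite /threshold -(invf_div K N) sqrtrV ?(ltW KN_gt0)//.
by rewrite ltr_pdivlMr// om_gt0.
Qed.

(** Multiplication by the positive [sin (mdist x0 x1 * om)] clears the denominators of [sigma_]; the
    two bounds on the distance select its trigonometric branch. *)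
Lemma KN_convex_expf : KN_convex K N f -> forall x0 x1 : X,
  0 < mdist x0 x1 -> mdist x0 x1 * om < pi ->
  exists2 g : R -> X, geodesic x0 x1 g & forall t : R, 0 <= t <= 1 ->
    F (g t) * sin (mdist x0 x1 * om) <=
      sin ((1 - t) * mdist x0 x1 * om) * F x0 + sin (t * mdist x0 x1 * om) * F x1.
Proof.
move=> cvx x0 x1 d0 dpi.
have dthr : mdist x0 x1 < threshold K N by rewrite lt_threshold.
have [g gg gf] := cvx x0 x1 (domain_star_bounded f_le _) (domain_star_bounded f_le _) dthr.
exists g => // t t01; have := gf t t01.
have sd : 0 < sin (mdist x0 x1 * om) by rewrite sin_gt0_pi// dpi mulr_gt0// om_gt0.
rewrite /sigma_ gt_eqF// dthr !(exp_functionalE f_le N0) -!EFinM -EFinD lee_fin.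
rewrite -(ler_pM2r sd) /s_ -/om => H; apply: le_trans H _.
rewrite le_eqVlt; apply/orP; left; apply/eqP; rewrite -/om.
by rewrite -/F; field; rewrite (gt_eqF sd) (gt_eqF om_gt0).
Qed.

End KN_facts.

(** * The EVIs as Dini bounds *)

Section evi_dini.
Context {R : realType} {X : pmetricType R}.
Variables (f : X -> \bar R) (M K N : R).
Hypotheses (f_le : forall x, (f x <= M%:E)%E) (K0 : K < 0) (N0 : N < 0).
Let om := Num.sqrt (K / N).
Let F := expf f N.
Let C := expR (- M / N).

Let lee_addEFin (D : \bar R) (k r : R) : (D + k%:E <= r%:E)%E = (D <= (r - k)%:E)%E.
Proof. by rewrite EFinB leeBrDr. Qed.

Lemma EVI_KN_dini (c : @curve R X) : EVI_KN K N f c <-> curves_in (domain f) c /\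
  forall t z, lifespan c.1 t -> mdist (c.2 t) z * om < pi ->
    dini_le (fun r => (sin (mdist (c.2 r) z / 2 * om) / om) ^+ 2) t
      (N / 2 * (1 - F z / F (c.2 t)) - K * (sin (mdist (c.2 t) z / 2 * om) / om) ^+ 2).
Proof.
split=> -[cin H]; split=> // t z tT.
  move=> dpi; apply/dini_leP; rewrite -lee_addEFin.
  by apply: H => //; [exact: domain_star_bounded f_le z|rewrite lt_threshold].
move=> _; rewrite lt_threshold// => dpi.
by have /dini_leP := H t z tT dpi; rewrite -lee_addEFin.
Qed.

Lemma EVI_dini (c : @curve R X) :
  EVI (- (K / N) * C) (exp_functional N f) (domain f) c <->
  curves_in (domain f) c /\ forall s, lifespan c.1 s -> lambda_at F C om c.2 s.
Proof.
have E s z : (F z - F (c.2 s) + C * om ^+ 2 / 2 * mdist (c.2 s) z ^+ 2) =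
    F z - F (c.2 s) - - (K / N) * C / 2 * mdist (c.2 s) z ^+ 2.
  by rewrite om_sq//; ring.
split=> -[cin H]; split=> //.
  move=> s sT z; apply/dini_leP; rewrite E -lee_addEFin EFinB -!(exp_functionalE f_le N0).
  (* As [f] is bounded above, [f_N] is finite everywhere and every [z] is admissible. *)
  by apply: H => //; rewrite /domain/= (exp_functionalE f_le N0).
move=> s z sT _; have /dini_leP := H s sT z.
by rewrite E -lee_addEFin EFinB -!(exp_functionalE f_le N0).
Qed.

End evi_dini.

(** * Continuity of curves on their lifespan *)

Lemma lifespan_open {R : realType} (T : \bar R) : open (lifespan T).
Proof. by rewrite openE => t tT; exact: near_lifespan. Qed.

Lemma lifespan_interval {R : realType} (T : \bar R) : is_interval (lifespan T).
Proof. by move=> a b aT bT r; exact: lifespan_itv. Qed.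

Section curves.
Context {R : realType} {X : pmetricType R}.
Variable D : set X.
Implicit Type c : @curve R X.

Lemma curves_in_continuous c t : curves_in D c -> lifespan c.1 t ->
  {for t, continuous c.2}.
Proof.
move=> [_ + _ _] tT; rewrite continuous_open_subspace; last exact: lifespan_open.
by apply; rewrite inE.
Qed.

Lemma curves_in_right c t : curves_in D c -> lifespan c.1 t ->
  c.2 (t + e) @[e --> (0 : R)^'+] --> c.2 t.
Proof.
move=> cin tT; apply: cvg_at_right_filter.
have H : t + e @[e --> (0 : R)] --> t.
  by rewrite -[X in _ --> X]addr0; apply: cvgD; [exact: cvg_cst|exact: cvg_id].
exact: (cvg_comp _ _ H (curves_in_continuous cin tT)).
Qed.

Lemma mdist_continuous_at (u : R -> X) t (z : X) : {for t, continuous u} ->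
  {for t, continuous (fun r => mdist (u r) z)}.
Proof.
move=> cu; apply/cvgrPdist_lt => eps eps0.
have : \forall r \near t, ball (u t) eps (u r) by apply: cu; exact: nbhsx_ballx.
apply: filterS => r; rewrite ballEmdist /= => d.
have := metric_triangle (u t) (u r) z; have := metric_triangle (u r) (u t) z.
rewrite (metric_sym (u r) (u t)) => ? ?.
by rewrite ltr_norml; apply/andP; split; lra.
Qed.

End curves.

(** * Reparametrized curves *)

Section reparametrization.
Context {R : realType} {X : pmetricType R}.
Variable f : X -> \bar R.
Variables (c : @curve R X) (al : R -> R).
Hypotheses (cC : Cprime f c) (cal : clock c.1 al).
Let T' := lim_at_end al c.1.
Let phi := pinv (lifespan c.1) al.
Let c' := reparametrize al c.

Let T0 : (0 < c.1)%E. Proof. by case: cC => -[]. Qed.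

Lemma reparametrizeE s : lifespan T' s -> c'.2 s = c.2 (phi s).
Proof. by move=> sT; rewrite /c' /reparametrize /= patchE mem_set. Qed.

Lemma reparametrize_Cprime : Cprime f c'.
Proof.
case: (cC) => cin c_ni; case: (cin) => _ _ cD _; split.
  split.
  - exact: clock_end_gt0.
  - rewrite continuous_open_subspace; last exact: lifespan_open.
    move=> s; rewrite inE => sT.
    have H : phi x @[x --> s] --> phi s := clock_cont (pinv_clock T0 cal) sT.
    have := cvg_comp _ _ H (curves_in_continuous cin (pinv_clock_lifespan T0 cal sT)).
    rewrite /continuous_at (reparametrizeE sT); apply: cvg_trans; apply: near_eq_cvg.
    by near=> x; rewrite reparametrizeE//; near: x; exact: near_lifespan.
  - by move=> s sT; rewrite reparametrizeE//; exact/cD/pinv_clock_lifespan.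
  - by move=> s sT; rewrite /c' /reparametrize /= patchE memNset.
move=> s t sT tT st; rewrite !reparametrizeE//.
by apply: c_ni; rewrite ?(clock_le (pinv_clock T0 cal))//; exact: pinv_clock_lifespan.
Unshelve. all: by end_near. Qed.

(** A clock that agrees with the inverse of [al] has [al] as its own inverse, so the second change
    of time undoes the first. *)
Lemma reparametrizeK (be : R -> R) : clock T' be ->
  (forall s, lifespan T' s -> be s = phi s) -> reparametrize be c' = c.
Proof.
move=> cbe bephi.
have T'0 := clock_end_gt0 T0 cal.
have endE : lim_at_end be T' = c.1.
  rewrite -[RHS](lim_at_end_pinv T0 cal) (lim_at_end_clock T'0 cbe).
  rewrite (lim_at_end_clock T'0 (pinv_clock T0 cal)).
  congr ereal_sup; apply/seteqP.
  by split => _ [s sT <-]; exists s => //; rewrite bephi.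
have pinvE t : lifespan c.1 t -> pinv (lifespan T') be t = al t.
  move=> tT; have aT := clock_lifespan T0 cal tT.
  have bet : be (al t) = t by rewrite bephi// /phi pinv_clockK.
  by rewrite -{1}bet (pinv_clockK cbe aT).
rewrite /reparametrize /= endE [RHS]surjective_pairing; congr pair.
apply/funext => t; rewrite patchE; case: ifPn => [|]; rewrite ?inE ?notin_setE => tT.
  rewrite /= pinvE//; apply: etrans (reparametrizeE (clock_lifespan T0 cal tT)) _.
  by rewrite /phi pinv_clockK.
(* Outside the lifespan both curves equal [point], by the normal form required in [curves_in]. *)
by case: cC => -[_ _ _ /(_ _ tT)].
Qed.

Lemma reparametrize_dini (h : X -> R) (s p a : R) : lifespan T' s -> 0 < p ->
  (al (phi s + e) - al (phi s)) / e @[e --> (0 : R)^'+] --> p ->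
  dini_le (h \o c.2) (phi s) a -> dini_le (h \o c'.2) s (p^-1 * a).
Proof.
move=> sT p0 dal dh.
have pcl := pinv_clock T0 cal.
have incr : \forall e \near (0 : R)^'+, phi s < phi (s + e).
  near=> e; apply: (clock_mono pcl) => //; last first.
    by rewrite ltrDl; near: e; exact: nbhs_right_gt.
  by near: e; exact: near_right_lifespan.
have p'0 : 0 < p^-1 by rewrite invr_gt0.
have := dini_le_time_change p'0 (clock_cont pcl sT) incr
  (pinv_clock_rderiv T0 cal sT p0 dal) dh.
apply: near_dini_le; first by rewrite /comp reparametrizeE.
near=> e; rewrite /comp reparametrizeE//.
by near: e; exact: near_right_lifespan.
Unshelve. all: by end_near. Qed.

End reparametrization.

(** * Monotonicity along EVI curves *)

Section monotone.
Context {R : realType} {X : pmetricType R}.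
Variables (f : X -> \bar R) (M K N : R).
Hypotheses (f_le : forall x, (f x <= M%:E)%E) (K0 : K < 0) (N0 : N < 0).
Hypothesis f_lsc : lower_semicontinuous f.
Let om := Num.sqrt (K / N).
Let F := expf f N.

(* If [F] increased along the curve, it would exceed its value at some [r0] on
   a right neighbourhood of [r0], where the EVI with [z := y r0] and a Gronwall
   argument would force the curve to stay at [y r0]. *)
Lemma EVI_KN_Cprime (c : @curve R X) : EVI_KN K N f c -> Cprime f c.
Proof.
move=> /(EVI_KN_dini f_le K0 N0)[cin H]; split=> // s t sT tT st.
rewrite -(le_expf f_le N0) -/F leNgt; apply/negP => gst.
have [||r0 [/andP[sr0 r0t] /= gr0 gP]] :=
    @last_point _ [set r | F (c.2 r) <= F (c.2 s)] s t st.
- exact: lexx.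
- move=> r /andP[sr rt] /=/negP; rewrite -ltNge => gr.
  have rT : lifespan c.1 r by apply: (lifespan_itv sT tT); rewrite (ltW sr).
  have near_gt : \forall x \near r, F (c.2 s) < F (c.2 x) :=
    curves_in_continuous cin rT (expf_lsc f_le N0 f_lsc gr).
  by apply: filterS near_gt => x /=; rewrite ltNge => /negP.
have r0_lt_t : r0 < t.
  rewrite lt_neqAle r0t andbT; apply/eqP => r0E.
  by move: gr0; rewrite r0E leNgt gst.
have r0T : lifespan c.1 r0 by apply: (lifespan_itv sT tT); rewrite sr0.
have K0' : 0 < - K by rewrite oppr_gt0.
have om0 := om_gt0 K0 N0.
set z := c.2 r0 in gr0 *.
(* A small [d] keeps the curve where the EVI at [z] applies, and [- K * d < 1] is needed for the
   Gronwall step. *)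
have : \forall d \near (0 : R)^'+, r0 + d <= t /\ (- K * d < 1 /\
    forall r, r0 <= r <= r0 + d -> mdist (c.2 r) z * om < pi).
  have cd := @mdist_continuous_at _ _ _ _ z (curves_in_continuous cin r0T).
  have /nbhs_ballP[e /= e0 eP] : \forall r \near r0, mdist (c.2 r) z < pi / om.
    by apply: cvgr_lt cd _ _; rewrite mdistxx divr_gt0// pi_gt0.
  near=> d; have d0 : 0 < d by near: d; exact: nbhs_right_gt.
  split; last split.
  - rewrite -lerBrDl; near: d; apply: nbhs_right_le; by rewrite subr_gt0.
  - rewrite -ltr_pdivlMl// mulr1; near: d; apply: nbhs_right_lt; by rewrite invr_gt0.
  - move=> r /andP[r0r rd]; rewrite -ltr_pdivlMr//; apply: eP.
    rewrite /ball/= distrC ger0_norm ?subr_ge0//.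
    have : d < e by near: d; exact: nbhs_right_lt.
    by lra.
move=> dP; have [d [d0 [dt [Kd dpi]]]] : exists d, 0 < d /\ r0 + d <= t /\ (- K * d < 1 /\
    forall r, r0 <= r <= r0 + d -> mdist (c.2 r) z * om < pi).
  by have [d] := filter_ex (filterI (@nbhs_right_gt R 0) dP); exists d.
have dT r : r0 <= r <= r0 + d -> lifespan c.1 r.
  move=> /andP[r0r rd]; apply: (lifespan_itv r0T tT).
  by rewrite r0r (le_trans rd).
pose h r := (sin (mdist (c.2 r) z / 2 * om) / om) ^+ 2.
have hc r : r0 <= r <= r0 + d -> {for r, continuous h}.
  move=> /dT rT; have cd := @mdist_continuous_at _ _ _ _ z (curves_in_continuous cin rT).
  have H1 : mdist (c.2 x) z / 2 * om @[x --> r] --> mdist (c.2 r) z / 2 * om.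
    by do 2 apply: cvgMl.
  have H2 := cvg_comp _ _ H1 (@continuous_sin R _).
  have H3 : sin (mdist (c.2 x) z / 2 * om) / om @[x --> r] --> sin (mdist (c.2 r) z / 2 * om) / om.
    by apply: cvgMl; exact: H2.
  exact: (@cvgM _ _ _ _ _ _ _ _ H3 H3).
have h_r0 : h r0 = 0 by rewrite /h mdistxx !mul0r sin0 mul0r expr0n.
have gpos r : r0 <= r <= r0 + d -> 0 < F (c.2 r).
  by move=> /dT rT; apply: (expf_gt0 _); case: cin => _ _ /(_ _ rT).
(* As [N < 0] and [F z <= F (c.2 r)] from [r0] on, the first term of the EVI is nonpositive. *)
have dh r : r0 <= r <= r0 + d -> dini_le h r (- K * h r).
  move=> rd; have := H r z (dT _ rd) (dpi _ rd); apply: dini_le_weaken.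
  rewrite -/(h r) mulNr gerDr nmulr_rle0; last by rewrite nmulr_rlt0 ?invr_gt0.
  rewrite subr_ge0 ler_pdivrMr ?gpos// mul1r.
  case/andP: rd; rewrite le_eqVlt => /predU1P[<-//|r0r rd].
  apply: (le_trans gr0); rewrite ltW// ltNge; apply/negP; apply: gP.
  by rewrite r0r (le_trans rd).
have d_ge0 : r0 <= r0 + d by rewrite lerDl ltW.
have chs : {within `[r0, r0 + d], continuous h}.
  by apply: continuous_in_subspaceT => r; rewrite inE/= in_itv/=; exact: hc.
(* Gronwall at a maximum point: [h m <= - K * d * h m] with a factor below 1 forces [h m <= 0]. *)
have [m] := EVT_max d_ge0 chs; rewrite in_itv/= => mrd hm.
have hm_le0 : h m <= 0.
  have /andP[r0m md] := mrd.
  have mrd' r : r0 <= r <= m -> r0 <= r <= r0 + d.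
    by move=> /andP[-> rm]; rewrite (le_trans rm).
  have := @dini_le_increment _ h r0 m (- K * h m) r0m.
  rewrite h_r0 subr0 => HH.
  have : h m <= - K * h m * (m - r0).
    apply: HH => [r /mrd'/hc//|r /andP[r0r rm]].
    have rrd : r0 <= r <= r0 + d by apply: mrd'; rewrite r0r ltW.
    apply: (dini_le_weaken _ (dh _ rrd)).
    by rewrite ler_pM2l// hm// in_itv.
  have hm0 : 0 <= h m by exact: sqr_ge0.
  have : - K * h m * (m - r0) <= - K * h m * d.
    by apply: ler_wpM2l; [rewrite mulr_ge0// ltW|rewrite lerBlDl].
  by nra.
(* At [r1] the value of [F] exceeds [F z], so the distance to [z] is positive and so is [h r1], a
   contradiction. *)
pose r1 := r0 + d; have r1d : r0 <= r1 <= r0 + d by rewrite d_ge0 lexx.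
have : h r1 <= 0 by rewrite (le_trans _ hm_le0)// hm// in_itv.
have gr1 : F z < F (c.2 r1).
  by rewrite (le_lt_trans gr0)// ltNge; apply/negP; apply: gP; rewrite ltrDl d0.
have dr1 : 0 < mdist (c.2 r1) z.
  by rewrite mdist_gt0; apply: contraTneq gr1 => ->; rewrite ltxx.
have dpi1 := dpi _ r1d.
rewrite leNgt exprn_gt0// divr_gt0// sin_gt0_pi// !mulr_gt0//=.
by have := @pi_gt0 R; lra.
Unshelve. all: by end_near. Qed.
End monotone.

(** * The clocks of [R1] and [R2] *)

Section Cprime_clocks.
Context {R : realType} {X : pmetricType R}.
Variables (f : X -> \bar R) (M N : R).
Hypotheses (f_le : forall x, (f x <= M%:E)%E) (N0 : N < 0).
Hypothesis f_lsc : lower_semicontinuous f.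
Let F := expf f N.
Let C := expR (- M / N).
Implicit Type c : @curve R X.

Lemma Cprime_le_expf c s t : Cprime f c -> lifespan c.1 s -> lifespan c.1 t -> s <= t ->
  F (c.2 t) <= F (c.2 s).
Proof. by move=> [_ c_ni] sT tT st; rewrite (le_expf f_le N0) c_ni. Qed.

Lemma Cprime_expf_gt0 c t : Cprime f c -> lifespan c.1 t -> 0 < F (c.2 t).
Proof. by move=> [[_ _ cD _] _] tT; exact: (expf_gt0 _ (cD _ tT)). Qed.

(** Lower semicontinuity bounds [F] from below near [t]; monotonicity bounds it from above to the
    right of [t]. *)
Lemma Cprime_right_continuous c t : Cprime f c -> lifespan c.1 t ->
  F (c.2 (t + e)) @[e --> (0 : R)^'+] --> F (c.2 t).
Proof.
move=> cC tT; apply/cvgrPdist_lt => eps eps0.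
have Fgt : F (c.2 t) - eps < F (c.2 t) by rewrite ltrBlDr ltrDl.
have near_gt : \forall e \near (0 : R)^'+, F (c.2 t) - eps < F (c.2 (t + e)) :=
  curves_in_right cC.1 tT (expf_lsc f_le N0 f_lsc Fgt).
near=> e; have tle : F (c.2 (t + e)) <= F (c.2 t).
  apply: (Cprime_le_expf cC) => //; first by near: e; exact: near_right_lifespan.
  by rewrite lerDl; near: e; exact: nbhs_right_ge.
rewrite ger0_norm ?subr_ge0// ltrBlDl -ltrBlDr.
by near: e.
Unshelve. all: by end_near. Qed.

Let itv_lifespan c t r : lifespan c.1 t -> `]0, t[%classic r -> lifespan c.1 r.
Proof. by move=> tT /=; rewrite in_itv/= => /andP[r0 /ltW]; exact: lifespan_le. Qed.

Definition R1_clock c t := - N * \int[lebesgue_measure]_(r in `]0, t[) (F (c.2 r))^-1.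

Definition R2_clock c t := - N^-1 * \int[lebesgue_measure]_(r in `]0, t[) F (c.2 r).

Let invF_le c s t : Cprime f c -> lifespan c.1 s -> lifespan c.1 t -> s <= t ->
  (F (c.2 s))^-1 <= (F (c.2 t))^-1.
Proof.
by move=> cC sT tT st; rewrite lef_pV2 ?posrE ?(Cprime_expf_gt0 cC)// (Cprime_le_expf cC).
Qed.

(** The inverse of [F] is nondecreasing along the curve, hence measurable, and bounded on [(0, t)]
    by its value at [t]. *)
Lemma R1_clockP c : Cprime f c -> clock c.1 (R1_clock c) /\
  forall t, lifespan c.1 t ->
    (R1_clock c (t + e) - R1_clock c t) / e @[e --> (0 : R)^'+] --> - N * (F (c.2 t))^-1.
Proof.
move=> cC; have c0 : (0 < c.1)%E by case: cC => -[].
have N0' : 0 < - N by rewrite oppr_gt0.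
have mw t : lifespan c.1 t -> measurable_fun `]0, t[ (fun r => (F (c.2 r))^-1).
  move=> tT; apply: nondecreasing_in_measurable; first exact: interval_is_interval.
  by move=> r s r0 s0 rs; apply: invF_le => //; exact: (itv_lifespan tT).
have w0 t : lifespan c.1 t -> 0 < (F (c.2 t))^-1.
  by move=> tT; rewrite invr_gt0 (Cprime_expf_gt0 cC).
have wb t : lifespan c.1 t -> exists B, forall r : R, 0 < r < t -> (F (c.2 r))^-1 <= B.
  move=> tT; exists (F (c.2 t))^-1 => r /andP[r0 /ltW rt].
  by apply: invF_le => //; exact: lifespan_le tT _ rt.
have wr t : lifespan c.1 t -> (F (c.2 (t + e)))^-1 @[e --> (0 : R)^'+] --> (F (c.2 t))^-1.
  move=> tT; apply: cvgV; first by rewrite gt_eqF// (Cprime_expf_gt0 cC).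
  exact: Cprime_right_continuous.
split; first exact: (integral_clock c0 N0' mw w0 wb wr).
exact: (integral_clock_rderiv N0' mw w0 wb wr).
Qed.

(** Here the integrand is nonincreasing, and its bound near 0 is [C], from the upper bound on
    [f]. *)
Lemma R2_clockP c : Cprime f c -> clock c.1 (R2_clock c) /\
  forall t, lifespan c.1 t ->
    (R2_clock c (t + e) - R2_clock c t) / e @[e --> (0 : R)^'+] --> - N^-1 * F (c.2 t).
Proof.
move=> cC; have c0 : (0 < c.1)%E by case: cC => -[].
have N0' : 0 < - N^-1 by rewrite oppr_gt0 invr_lt0.
have mw t : lifespan c.1 t -> measurable_fun `]0, t[ (fun r => F (c.2 r)).
  move=> tT; apply: nonincreasing_in_measurable; first exact: interval_is_interval.
  by move=> r s r0 s0 rs; apply: Cprime_le_expf => //; exact: (itv_lifespan tT).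
have w0 t : lifespan c.1 t -> 0 < F (c.2 t) by exact: Cprime_expf_gt0.
have wb t : lifespan c.1 t -> exists B, forall r : R, 0 < r < t -> F (c.2 r) <= B.
  by move=> tT; exists C => r _; exact: expf_le.
have wr t : lifespan c.1 t -> F (c.2 (t + e)) @[e --> (0 : R)^'+] --> F (c.2 t).
  exact: Cprime_right_continuous.
split; first exact: (integral_clock c0 N0' mw w0 wb wr).
exact: (integral_clock_rderiv N0' mw w0 wb wr).
Qed.

Lemma R1E c : R1 N f c = reparametrize (R1_clock c) c. Proof. by []. Qed.

Lemma R2E c : R2 N f c = reparametrize (R2_clock c) c. Proof. by []. Qed.

Lemma R1_Cprime c : Cprime f c -> Cprime f (R1 N f c).
Proof. by move=> cC; apply: reparametrize_Cprime => //; exact: (R1_clockP cC).1. Qed.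

Lemma R2_Cprime c : Cprime f c -> Cprime f (R2 N f c).
Proof. by move=> cC; apply: reparametrize_Cprime => //; exact: (R2_clockP cC).1. Qed.

Let c_gt0 c : Cprime f c -> (0 < c.1)%E. Proof. by case=> -[]. Qed.

(** The clock of [R2] on the new curve and the inverse of the clock of [R1] have the same right
    derivative, so [clock_unique] identifies them. *)
Lemma R2K c : Cprime f c -> R2 N f (R1 N f c) = c.
Proof.
move=> cC; have [cal dal] := R1_clockP cC; have [cbe dbe] := R2_clockP (R1_Cprime cC).
have c0 := c_gt0 cC.
apply: (reparametrizeK cC cal cbe) => s sT.
apply: (clock_unique cbe (pinv_clock c0 cal) dbe _ sT) => t tT.
have pT := pinv_clock_lifespan c0 cal tT.
rewrite R1E reparametrizeE//.
have := pinv_clock_rderiv c0 cal tT _ (dal _ pT).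
rewrite invfM invrN invrK; apply.
by rewrite mulr_gt0 ?oppr_gt0// invr_gt0 (Cprime_expf_gt0 cC).
Qed.

Lemma R1K c : Cprime f c -> R1 N f (R2 N f c) = c.
Proof.
move=> cC; have [cal dal] := R2_clockP cC; have [cbe dbe] := R1_clockP (R2_Cprime cC).
have c0 := c_gt0 cC.
apply: (reparametrizeK cC cal cbe) => s sT.
apply: (clock_unique cbe (pinv_clock c0 cal) dbe _ sT) => t tT.
have pT := pinv_clock_lifespan c0 cal tT.
rewrite R2E reparametrizeE//.
have := pinv_clock_rderiv c0 cal tT _ (dal _ pT).
rewrite invfM invrN invrK; apply.
by rewrite mulr_gt0 ?oppr_gt0 ?invr_lt0// (Cprime_expf_gt0 cC).
Qed.

(** [f_N] is bounded by [C] and the integral runs over an interval of length at most 1. *)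
Lemma Cprime_Csecond c : Cprime f c -> Csecond N f c.
Proof.
move=> cC; split => //; set D := lifespan _.
have DT r : D r -> lifespan c.1 r /\ (r%:E < 1)%E.
  by move=> [r0]; rewrite lt_min => /andP[? ?].
have mD : measurable D by apply: is_interval_measurable; exact: lifespan_interval.
have mF : measurable_fun D (fun t => F (c.2 t)).
  apply: nonincreasing_in_measurable; first exact: lifespan_interval.
  by move=> r s /DT[rT _] /DT[sT _]; exact: (Cprime_le_expf cC).
apply: (@le_lt_trans _ _ (\int[lebesgue_measure]_(t in D) C%:E)%E).
  under eq_integral do rewrite (exp_functionalE f_le N0).
  apply: ge0_le_integral => //.
  - by move=> t _; rewrite lee_fin expf_ge0.
  - exact/measurable_EFinP.
  - by move=> t _; rewrite lee_fin; exact: expf_le.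
rewrite integral_cst// lte_mul_pinfty// ?lee_fin ?expR_ge0//.
apply: (@le_lt_trans _ _ (lebesgue_measure (`]0, 1[ : set R))).
  apply: le_measure; rewrite ?inE//.
  by move=> r Dr /=; rewrite in_itv/=; have [[-> _]] := DT _ Dr; rewrite lte_fin.
by rewrite lebesgue_measure_itv/= lte_fin ltr01 -EFinB ltry.
Qed.

End Cprime_clocks.

(** * The two inclusions and the bijections *)

Theorem proposition3p10 (R : realType) (X : pmetricType R)
  (X_intrinsic : strictly_intrinsic X)
  (Xhat : metricType R) (i : X -> Xhat) (Xhat_completion : is_completion i)
  (Xhat_geodesic : strictly_intrinsic Xhat)
  (f : X -> \bar R) (f_proper : domain f !=set0) (f_dense : dense (domain f))
  (f_lsc : lower_semicontinuous f)
  (M : R) (f_le : forall x, (f x <= M%:E)%E)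
  (K N : R) (K_lt0 : K < 0) (N_lt0 : N < 0) (f_convex : KN_convex K N f) :
  let fN := exp_functional N f in
  let Mt := - (K / N) * expR (- M / N) in
  let A := EVI_KN K N f in
  let B := EVI Mt fN (domain f) `&` Csecond N f in
  [/\ R1 N f @` A `<=` B,
      R2 N f @` B `<=` A,
      set_bij A B (R1 N f) &
      set_bij B A (R2 N f)].
Proof.
move=> fN Mt A B.
have AC c : A c -> Cprime f c by exact: (EVI_KN_Cprime f_le).
have BC c : B c -> Cprime f c by move=> [_ []].
have F0 := expf_ge0 f N.
have FC := expf_le f_le N_lt0.
have om0 := om_gt0 K_lt0 N_lt0.
have cvx := KN_convex_expf f_le K_lt0 N_lt0 f_convex.
have R1AB c : A c -> B (R1 N f c).
  move=> Ac; have cC := AC _ Ac; have c0 : (0 < c.1)%E by case: cC => -[].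
  have c'C := R1_Cprime f_le N_lt0 f_lsc cC.
  split; last exact: (Cprime_Csecond f_le).
  apply/(EVI_dini f_le K_lt0 N_lt0); split => [|s sT]; first by case: c'C.
  have [cal dal] := R1_clockP f_le N_lt0 f_lsc cC.
  have pT := pinv_clock_lifespan c0 cal sT.
  have Fp := Cprime_expf_gt0 N cC pT.
  apply: (lambda_at_of_KN_at F0 FC om0 X_intrinsic cvx (curves_in_right c'C.1 sT)).
  have [_ cE] := (EVI_KN_dini f_le K_lt0 N_lt0 c).1 Ac.
  move=> z; rewrite R1E reparametrizeE// => dpi.
  have p0 : 0 < - N * (expf f N (c.2 (pinv (lifespan c.1) (R1_clock f N c) s)))^-1.
    by rewrite mulr_gt0 ?oppr_gt0 ?invr_gt0.
  (* The clock of [R1] has right derivative [- N / F], so the EVI is multiplied by [F / (- N)],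
     which turns its bound into that of [KN_at]. *)
  have := reparametrize_dini (h := fun x => (sin (mdist x z / 2 * Num.sqrt (K / N)) /
    Num.sqrt (K / N)) ^+ 2) cC cal sT p0 (dal _ pT) (cE _ _ pT dpi).
  apply: dini_le_weaken; rewrite (om_sq K_lt0 N_lt0) le_eqVlt; apply/orP; left.
  by apply/eqP; field; rewrite (gt_eqF om0) (lt_eqF N_lt0) (gt_eqF Fp).
have R2BA c : B c -> A (R2 N f c).
  move=> Bc; have cC := BC _ Bc; have c0 : (0 < c.1)%E by case: cC => -[].
  have c'C := R2_Cprime f_le N_lt0 f_lsc cC.
  apply/(EVI_KN_dini f_le K_lt0 N_lt0); split => [|t z tT]; first by case: c'C.
  have [cal dal] := R2_clockP f_le N_lt0 f_lsc cC.
  have pT := pinv_clock_lifespan c0 cal tT.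
  have Fp := Cprime_expf_gt0 N cC pT.
  have [_ /(_ _ pT) cE] := (EVI_dini f_le K_lt0 N_lt0 c).1 Bc.1.
  (* Here the pointwise equivalence comes first, on [c] itself, and the change of time second. *)
  have KN := KN_at_of_lambda_at F0 FC om0 cvx (curves_in_right cC.1 pT) cE.
  rewrite R2E reparametrizeE// => dpi.
  have p0 : 0 < - N^-1 * expf f N (c.2 (pinv (lifespan c.1) (R2_clock f N c) t)).
    by rewrite mulr_gt0 ?oppr_gt0 ?invr_lt0.
  have := reparametrize_dini (h := fun x => (sin (mdist x z / 2 * Num.sqrt (K / N)) /
    Num.sqrt (K / N)) ^+ 2) cC cal tT p0 (dal _ pT) (KN _ dpi).
  apply: dini_le_weaken; rewrite (om_sq K_lt0 N_lt0) le_eqVlt; apply/orP; left.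
  by apply/eqP; field; rewrite (gt_eqF om0) (lt_eqF N_lt0) (gt_eqF Fp).
(* These inverse relations give both injectivity and surjectivity. *)
have R2R1 c : A c -> R2 N f (R1 N f c) = c.
  by move=> /AC; exact: (R2K f_le).
have R1R2 c : B c -> R1 N f (R2 N f c) = c.
  by move=> /BC; exact: (R1K f_le).
split.
- by move=> _ [c Ac <-]; exact: R1AB.
- by move=> _ [c Bc <-]; exact: R2BA.
- split.
  + by move=> c Ac; exact: R1AB.
  + by move=> c d; rewrite !inE => Ac Ad e; rewrite -(R2R1 _ Ac) e R2R1.
  + by move=> c Bc; exists (R2 N f c); [exact: R2BA|exact: R1R2].
- split.
  + by move=> c Bc; exact: R2BA.
  + by move=> c d; rewrite !inE => Bc Bd e; rewrite -(R1R2 _ Bc) e R1R2.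
  + by move=> c Ac; exists (R1 N f c); [exact: R1AB|exact: R2R1].
Qed.
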